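(* Assume that $k$ is uncountable. Let $X, Y$ be irreducible affine varieties over $k$ and let $\theta \colon \mathrm{Aut}(X) \to \mathrm{Aut}(Y)$ be an isomorphism of abstract groups. Then $\theta$ maps unipotent elements to unipotent elements.
   Context: $k$ is an algebraically closed field of characteristic zero. An element $\varphi \in \mathrm{Aut}(X)$ of the automorphism group of an affine variety $X$ is called unipotent if there is an algebraic action of the additive group $\mathbb{G}_a$ on $X$ such that $\varphi$ lies in the image of the induced homomorphism $\mathbb{G}_a \to \mathrm{Aut}(X)$. *)

(* Defs.v *)
From HB Require Import structures.
From mathcomp Require Import all_boot all_algebra.
From mathcomp Require Import boolp classical_sets cardinality mpoly.

Set Implicit Arguments.
Unset Strict Implicit.
Unset Printing Implicit Defensive.

Import GRing.Theory.
Local Open Scope ring_scope.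
Local Open Scope classical_set_scope.

(* Affine varieties over an algebraically closed field are modelled by their
   closed points: a variety is a Zariski-closed subset of some k^n, with points
   written as row vectors; such a subset coerces to the type of its points. *)
Section AffineVarieties.
Variable k : closedFieldType.

Definition zero_locus n (S : set {mpoly k[n]}) : set 'rV[k]_n :=
  [set x | forall p, S p -> p.@[x ord0] = 0].

Definition zariski_closed n (Z : set 'rV[k]_n) : Prop :=
  exists S : set {mpoly k[n]}, Z = zero_locus S.

Record affine_variety := AffineVariety {
  ambient_dim : nat;
  points :> set 'rV[k]_ambient_dim;
  points_closed : zariski_closed points }.

Arguments points : clear implicits.

Definition irreducible_variety (X : affine_variety) : Prop :=
  X !=set0 /\
  forall A B : set 'rV[k]_(ambient_dim X),
    zariski_closed A -> zariski_closed B ->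
    X `<=` A `|` B -> X `<=` A \/ X `<=` B.

Definition regular (X Y : affine_variety) (f : X -> Y) : Prop :=
  exists P : 'I_(ambient_dim Y) -> {mpoly k[ambient_dim X]},
    forall x : X, \val (f x) = \row_i (P i).@[\val x ord0].

Lemma regular_id (X : affine_variety) : regular (@id X).
Proof.
exists (fun i => 'X_i) => x; apply/rowP => i.
by rewrite mxE mevalXU.
Qed.

Lemma regular_comp (X Y Z : affine_variety) (g : Y -> Z) (f : X -> Y) :
  regular g -> regular f -> regular (g \o f).
Proof.
move=> [Q gQ] [P fP]; exists (fun i => Q i \mPo [tuple P j | j < _]) => x.
apply/rowP => i; rewrite /= gQ !mxE comp_mpoly_meval.
by apply: meval_eq => j; rewrite fP mxE tnth_mktuple.
Qed.

Lemma affine_space_closed n : zariski_closed [set: 'rV[k]_n].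
Proof. by exists set0; rewrite eqEsubset; split=> [x _ p|x _]. Qed.

Definition affine_space n := AffineVariety (affine_space_closed n).

Section Product.
Variables X Y : affine_variety.
Let m := ambient_dim X.
Let n := ambient_dim Y.

Definition prod_points : set 'rV[k]_(m + n) :=
  [set z | points X (lsubmx z) /\ points Y (rsubmx z)].

Lemma prod_points_closed : zariski_closed prod_points.
Proof.
have [S XS] := points_closed X; have [T YT] := points_closed Y.
exists ([set p \mPo [tuple 'X_(lshift n i) | i < m] | p in S] `|`
        [set p \mPo [tuple 'X_(rshift m i) | i < n] | p in T]).
have evl (p : {mpoly k[m]}) (z : 'rV[k]_(m + n)) :
    (p \mPo [tuple 'X_(lshift n i) | i < m]).@[z ord0]
    = p.@[lsubmx z ord0].
  by rewrite comp_mpoly_meval; apply: meval_eq => i;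
     rewrite tnth_mktuple mevalXU mxE.
have evr (p : {mpoly k[n]}) (z : 'rV[k]_(m + n)) :
    (p \mPo [tuple 'X_(rshift m i) | i < n]).@[z ord0]
    = p.@[rsubmx z ord0].
  by rewrite comp_mpoly_meval; apply: meval_eq => i;
     rewrite tnth_mktuple mevalXU mxE.
apply/seteqP; split=> z; rewrite /prod_points XS YT /zero_locus /=.
  by move=> [zS zT] _ [[p Sp <-]|[p Tp <-]]; rewrite ?evl ?evr; auto.
move=> z0; split=> p Sp.
  by rewrite -evl; apply: z0; left; exists p.
by rewrite -evr; apply: z0; right; exists p.
Qed.

Definition prod_variety := AffineVariety prod_points_closed.

Definition prod_fst (z : prod_variety) : X :=
  exist _ (lsubmx (\val z)) (mem_set (set_mem (valP z)).1).

Definition prod_snd (z : prod_variety) : Y :=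
  exist _ (rsubmx (\val z)) (mem_set (set_mem (valP z)).2).

End Product.

Arguments prod_points : clear implicits.

Section Automorphisms.
Variable X : affine_variety.

Record automorphism := Automorphism {
  aut_fun :> X -> X;
  aut_inv : X -> X;
  aut_regular : regular aut_fun;
  aut_inv_regular : regular aut_inv;
  aut_funK : cancel aut_fun aut_inv;
  aut_invK : cancel aut_inv aut_fun }.

Lemma automorphism_ext (f g : automorphism) : f =1 g -> f = g.
Proof.
case: f g => [f f' rf rf' fK f'K] [g g' rg rg' gK g'K] /= fg.
have {}fg : f = g by apply: funext.
have fg' : f' = g' by apply: funext => x; rewrite -{1}[x]g'K -fg fK.
by subst g g'; congr Automorphism; apply: Prop_irrelevance.
Qed.

Definition aut_one : automorphism :=
  Automorphism (@regular_id X) (@regular_id X) (fun=> erefl) (fun=> erefl).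

Definition aut_mul (f g : automorphism) : automorphism :=
  Automorphism
    (regular_comp (aut_regular f) (aut_regular g))
    (regular_comp (aut_inv_regular g) (aut_inv_regular f))
    (can_comp (@aut_funK f) (@aut_funK g))
    (can_comp (@aut_invK g) (@aut_invK f)).

Definition aut_invg (f : automorphism) : automorphism :=
  Automorphism (aut_inv_regular f) (aut_regular f)
    (@aut_invK f) (@aut_funK f).

Lemma aut_mulA : associative aut_mul.
Proof. by move=> f g h; apply: automorphism_ext. Qed.

Lemma aut_mul1f : left_id aut_one aut_mul.
Proof. by move=> f; apply: automorphism_ext. Qed.

Lemma aut_mulf1 : right_id aut_one aut_mul.
Proof. by move=> f; apply: automorphism_ext. Qed.

Lemma aut_mulVf : left_inverse aut_one aut_invg aut_mul.
Proof. by move=> f; apply: automorphism_ext => x /=; rewrite aut_funK. Qed.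

Lemma aut_mulfV : right_inverse aut_one aut_invg aut_mul.
Proof. by move=> f; apply: automorphism_ext => x /=; rewrite aut_invK. Qed.

HB.instance Definition _ := gen_eqMixin automorphism.
HB.instance Definition _ := gen_choiceMixin automorphism.
HB.instance Definition _ :=
  isGroup.Build automorphism aut_mulA aut_mul1f aut_mulf1 aut_mulVf aut_mulfV.

(* The additive group is the affine line with addition; its points are
   identified with k through the unique coordinate. *)
Record Ga_action := GaAction {
  Ga_act :> k -> X -> X;
  Ga_act_regular : @regular (prod_variety (affine_space 1) X) X
    (fun z => Ga_act (\val (prod_fst z) ord0 ord0) (prod_snd z));
  Ga_act0 : forall x, Ga_act 0 x = x;
  Ga_actD : forall s t x, Ga_act (s + t) x = Ga_act s (Ga_act t x) }.

Section InducedHomomorphism.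
Variable a : Ga_action.

Lemma Ga_aut_regular t : regular (a t).
Proof.
have [P aP] := Ga_act_regular a.
pose n := ambient_dim X.
exists (fun i => P i \mPo
  [tuple match split j with inl _ => t%:MP | inr l => 'X_l end | j < 1 + n]).
move=> x.
have zP : row_mx t%:M (\val x) \in prod_points (affine_space 1) X.
  by apply/mem_set; split => //=; rewrite row_mxKr; apply: set_mem (valP x).
pose z : prod_variety (affine_space 1) X := exist _ (row_mx t%:M (\val x)) zP.
have zx : prod_snd z = x by apply: val_inj; rewrite /= row_mxKr.
have zt : \val (prod_fst z) ord0 ord0 = t by rewrite /= row_mxKl mxE eqxx.
have := aP z; rewrite zx zt => ->.
apply/rowP => i; rewrite !mxE comp_mpoly_meval; apply: meval_eq => j.
rewrite tnth_mktuple mxE; case: (split j) => l.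
  by rewrite (ord1 l) mxE eqxx mulr1n mevalC.
by rewrite mevalXU.
Qed.

Lemma Ga_actK t : cancel (a t) (a (- t)).
Proof. by move=> x; rewrite -Ga_actD addNr Ga_act0. Qed.

Lemma Ga_actVK t : cancel (a (- t)) (a t).
Proof. by move=> x; rewrite -Ga_actD subrr Ga_act0. Qed.

Definition Ga_aut (t : k) : automorphism :=
  Automorphism (Ga_aut_regular t) (Ga_aut_regular (- t))
    (@Ga_actK t) (@Ga_actVK t).

Lemma Ga_autD s t : Ga_aut (s + t) = (Ga_aut s * Ga_aut t)%g.
Proof. by apply: automorphism_ext => x /=; rewrite Ga_actD. Qed.

End InducedHomomorphism.

Definition unipotent (phi : automorphism) : Prop :=
  exists a : Ga_action, range (Ga_aut a) phi.

End Automorphisms.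
End AffineVarieties.

(* Main.v *)
(** A nontrivial unipotent phi lies in a one-parameter group a(t), t in k, and by
    polynomiality in t all the a(t) with t <> 0 have the same centralizer.  The
    double centralizer of such an a(t) consists of unipotent elements, hence is
    torsion free: its elements commute with x |-> a(q x) x for every invariant
    function q, therefore fix all invariants, therefore are generically of the
    form x |-> a(c x) x with c invariant.  So it suffices to find t <> 0 with
    theta(a(t)) unipotent, as theta phi lies in its double centralizer.

    Let H = theta(a(k)), an uncountable family of commuting automorphisms of Y.
    Its span in the space of polynomial maps is a commutative algebra of
    countable dimension over the uncountable field k.  In a domain of that kind
    uncountably many units lying, with their inverses, in a finite dimensional
    space cannot be pairwise non-proportional: otherwise one of them takes at two
    k-points values whose ratio is transcendental over a countable algebraically
    closed field of definition k0, and a place of k over k0 at which this ratio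
    vanishes contradicts the absence of zero divisors.  Hence some theta(a(t))
    with t <> 0 acts locally finitely on functions.  An eigenvalue other than 1
    would give, through a torsion character of the group generated by the
    eigenvalues, a nontrivial automorphism of finite order in the double
    centralizer; so theta(a(t)) is unipotent. *)

From HB Require Import structures.
Require Import Defs.
From mathcomp Require Import all_boot all_algebra.
From mathcomp Require Import boolp classical_sets cardinality functions mpoly.
From mathcomp Require Import ring.

Set Implicit Arguments.
Unset Strict Implicit.
Unset Printing Implicit Defensive.
Import GRing.Theory.
Local Open Scope ring_scope.
Local Open Scope classical_set_scope.

(** [Zorn_bigcup] also has to handle the empty chain. Applied to the sets whose union with [A0]
    satisfies [P], it sends the empty chain to [A0] itself. *)
Lemma Zorn_above (T : Type) (P : set (set T)) (A0 : set T) :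
  P A0 ->
  (forall F : set (set T), F `<=` P -> F !=set0 -> total_on F subset ->
     P (\bigcup_(X in F) X)) ->
  exists A, [/\ A0 `<=` A, P A & forall B, A `<=` B -> P B -> B `<=` A].
Proof.
move=> PA0 Pchain.
have [|A [PA Amax]] := @Zorn_bigcup T [set A | P (A `|` A0)].
  move=> F FP Ftot /=.
  have [[X0 FX0]|/nonemptyPn F0] := pselect (F !=set0); last first.
    by rewrite F0 bigcup_set0 set0U.
  have -> : (\bigcup_(X in F) X) `|` A0 =
      \bigcup_(Y in [set X `|` A0 | X in F]) Y.
    apply/seteqP; split=> x /=.
      move=> [[X FX Xx]|A0x]; first by exists (X `|` A0); [exists X|left].
      by exists (X0 `|` A0); [exists X0|right].
    by move=> [_ [X FX <-]] [Xx|A0x]; [left; exists X|right].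
  apply: Pchain; first by move=> _ [X FX <-]; apply: FP.
    by exists (X0 `|` A0); exists X0.
  move=> _ _ [X FX <-] [Y FY <-]; have [XY|YX] := Ftot _ _ FX FY.
    by left; apply: setSU.
  by right; apply: setSU.
exists (A `|` A0); split=> // B AB PB; apply: contrapT => BA.
apply: (Amax B).
  split; first by move=> x Ax; apply: AB; left.
  by move=> BA'; apply: BA => x Bx; left; apply: BA'.
have BE : B `|` A0 = B by apply/setUidPl => x A0x; apply: AB; right.
by rewrite /= BE.
Qed.

(** * Places of algebraically closed fields *)

Section Places.
Variables (k : closedFieldType) (k0 : divringClosed k).
Hypothesis k0_closed : forall (p : {poly k}) x,
  p \is a polyOver k0 -> p != 0 -> root p x -> x \in k0.

(** When nonempty, [m] is a proper ideal of the ring k0 + m, with residue field [k0]. Places arise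
    as the maximal sets of this kind. *)
Definition nonunital (m : set k) : Prop :=
  [/\ forall x y, m x -> m y -> m (x + y), forall x y, m x -> m y -> m (x * y),
      forall c x, c \in k0 -> m x -> m (c * x) & ~ m 1].

(* This says that k0 + m is a valuation ring of k with maximal ideal m and
   residue field k0. *)
Definition place (m : set k) : Prop :=
  nonunital m /\
  forall z, (exists2 c, c \in k0 & m (z - c)) \/ (z != 0 /\ m z^-1).

Section Maximal.
Variable m : set k.
Hypothesis mP : nonunital m.
Hypothesis m_max : forall n, m `<=` n -> nonunital n -> n `<=` m.

Let mD := let: And4 h _ _ _ := mP in h.
Let mM := let: And4 _ h _ _ := mP in h.
Let mZ := let: And4 _ _ h _ := mP in h.
Let m1 := let: And4 _ _ _ h := mP in h.

Let mN x : m x -> m (- x).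
Proof. by move=> mx; rewrite -mulN1r; apply: mZ; rewrite ?rpredN ?rpred1. Qed.

Let mu_neq0 x : m x -> 1 + x != 0.
Proof.
move=> mx; apply/eqP => /eqP; rewrite addrC addr_eq0 => /eqP xE.
by apply: m1; rewrite -[1]opprK -xE; apply: mN.
Qed.

(** Localizing [m] at the elements 1 + b, with b in [m], gives a nonunital set again, which by
    maximality is no larger than [m]. *)
Lemma maximal_inv1D x y : m x -> m y -> m (y / (1 + x)).
Proof.
move=> mx my.
pose n := [set z | exists a b, [/\ m a, m b & z = a / (1 + b)]].
suff : n `<=` m by apply; exists y, x.
have mab a b : m a -> m b -> m (a + b + a * b).
  by move=> ma mb; do !apply: mD => //; apply: mM.
apply: m_max => [z mz|].
  exists (z * (1 + z)), z; split=> //; last by rewrite mulfK ?mu_neq0.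
  by rewrite mulrDr mulr1; apply: mD => //; apply: mM.
split.
- move=> _ _ [a [b [ma mb ->]]] [c [d [mc md ->]]].
  exists (a * (1 + d) + c * (1 + b)), (b + d + b * d); split; [|exact: mab|].
    by rewrite !mulrDr !mulr1; do !apply: mD => //; apply: mM.
  have hb := mu_neq0 mb; have hd := mu_neq0 md.
  have -> : 1 + (b + d + b * d) = (1 + b) * (1 + d) by ring.
  by field; rewrite hb hd.
- move=> _ _ [a [b [ma mb ->]]] [c [d [mc md ->]]].
  exists (a * c), (b + d + b * d); split; [exact: mM|exact: mab|].
  have hb := mu_neq0 mb; have hd := mu_neq0 md.
  have -> : 1 + (b + d + b * d) = (1 + b) * (1 + d) by ring.
  by field; rewrite hb hd.
- move=> e _ ek [a [b [ma mb ->]]]; exists (e * a), b.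
  by split=> //; [apply: mZ|rewrite mulrA].
- move=> [a [b [ma mb /esym/eqP]]]; rewrite -subr_eq0.
  have hb := mu_neq0 mb.
  have -> : a / (1 + b) - 1 = (a - b - 1) / (1 + b) by field.
  rewrite mulf_eq0 invr_eq0 (negPf hb) orbF subr_eq0 => /eqP ab.
  by apply: m1; rewrite -ab; apply: mD => //; apply: mN.
Qed.

Let O := [set z | exists2 c, c \in k0 & m (z - c)].

Let m0 x : m x -> m 0.
Proof. by move=> mx; rewrite -(mul0r x); apply: mZ; rewrite ?rpred0. Qed.

Lemma maximal_unit z : O z -> ~ m z -> m !=set0 -> O z^-1.
Proof.
move=> [c ck mzc] mz [x0 mx0]; have [c0|c0] := eqVneq c 0.
  by case: mz; rewrite c0 subr0 in mzc.
have zE : z = c * (1 + c^-1 * (z - c)) by field.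
have mt : m (c^-1 * (z - c)) by apply: mZ; rewrite ?rpredV.
exists c^-1; first by rewrite rpredV.
have h := mu_neq0 mt; set t := c^-1 * (z - c) in zE mt h *.
have -> : z^-1 - c^-1 = - c^-1 * (t / (1 + t)).
  by rewrite zE; field; rewrite h.
by apply: mZ; [rewrite rpredN rpredV|apply: maximal_inv1D].
Qed.

(** The second alternative says that 1 lies in m[z]. If it does not, [m] absorbs z by maximality,
    and a [z] not congruent to any scalar would have all z - c invertible modulo [m]; factoring a
    polynomial over [k0] then puts 1 in [m]. *)
Lemma maximal_extend z : m !=set0 ->
  O z \/ exists p : {poly k}, (forall i, m p`_i) /\ p.[z] = 1.
Proof.
move=> [x0 mx0]; have mm0 := m0 mx0.
have [|np] := pselect (exists p : {poly k}, (forall i, m p`_i) /\ p.[z] = 1).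
  by right.
left; pose n := [set y | exists p : {poly k}, (forall i, m p`_i) /\ y = p.[z]].
have msum I (r : seq I) (P : pred I) (f : I -> k) : (forall i, P i -> m (f i)) ->
    m (\sum_(i <- r | P i) f i).
  by move=> mf; elim/big_ind: _.
have mn : m `<=` n.
  move=> y my; exists y%:P; split=> [i|]; last by rewrite hornerC.
  by rewrite coefC; case: ifP.
have nP : nonunital n.
  split.
  - move=> _ _ [p [pm ->]] [q [qm ->]]; exists (p + q).
    by split=> [i|]; rewrite ?coefD ?hornerD //; apply: mD.
  - move=> _ _ [p [pm ->]] [q [qm ->]]; exists (p * q).
    by split=> [i|]; rewrite ?coefM ?hornerM //; apply: msum => j _; apply: mM.
  - move=> c _ ck [p [pm ->]]; exists (c *: p).
    by split=> [i|]; rewrite ?coefZ ?hornerZ //; apply: mZ.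
  - by move=> [p [pm p1]]; apply: np; exists p.
have mz y : m y -> m (y * z).
  move=> my; apply: (m_max mn nP); exists (y *: 'X); split=> [i|].
    by rewrite coefZ coefX; case: (i == 1%N); rewrite ?mulr1 ?mulr0.
  by rewrite hornerZ hornerX.
have mpz (p : {poly k}) y : p \is a polyOver k0 -> m y -> m (p.[z] * y).
  move=> pk my; rewrite horner_coef mulr_suml; apply: msum => i _.
  rewrite -mulrA; apply: mZ; first by apply/polyOverP.
  elim: (nat_of_ord i) => [|j IH]; first by rewrite mul1r.
  by rewrite exprSr mulrAC; apply: mz.
apply: contrapT => Oz.
(* Adjoining z - c to [m] must produce 1, since otherwise maximality would put z - c in [m]. *)
have inv c : c \in k0 ->
    exists2 q : {poly k}, q \is a polyOver k0 & m (1 - (z - c) * q.[z]).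
  move=> ck; pose l := [set y | exists a (q : {poly k}),
    [/\ m a, q \is a polyOver k0 & y = a + (z - c) * q.[z]]].
  have ml : m `<=` l.
    by move=> a ma; exists a, 0; rewrite rpred0 horner0 mulr0 addr0.
  have [lP|] := pselect (nonunital l).
    case: Oz; exists c => //; apply: (m_max ml lP); exists 0, 1.
    by rewrite rpred1 !hornerE ?add0r ?mulr1.
  move=> nl; suff [a [q [ma qk e]]] : l 1.
    by exists q; rewrite // e addrK.
  apply: contrapT => l1; apply: nl; split=> //.
  - move=> _ _ [a [p [ma pk ->]]] [b [q [mb qk ->]]].
    exists (a + b), (p + q); rewrite rpredD // hornerD; split=> //.
      exact: mD.
    by ring.
  - move=> _ _ [a [p [ma pk ->]]] [b [q [mb qk ->]]].
    pose P : {poly k} := 'X - c%:P.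
    have Pk : P \is a polyOver k0 by rewrite polyOverXsubC.
    exists (a * b + ((P * p).[z] * b + (P * q).[z] * a)), (P * p * q).
    split; [|by rewrite !rpredM|].
      by apply: mD; [apply: mM|apply: mD; apply: mpz; rewrite ?rpredM].
    by rewrite !hornerM !hornerXsubC; ring.
  - move=> e _ ek [a [p [ma pk ->]]]; exists (e * a), (e *: p).
    by rewrite polyOverZ // hornerZ; split=> //; [apply: mZ|ring].
(* For c = 0 this gives a nonzero polynomial [P] over [k0] with P(z) in [m]. Its roots lie in [k0],
   so a product of factors z - c lies in [m]; each factor can be cancelled, which leaves 1 in
   [m]. *)
have [q0 q0k] := inv 0 (rpred0 _); rewrite subr0 => mP0.
pose P : {poly k} := 1 - 'X * q0.
have Pk : P \is a polyOver k0 by rewrite rpredB ?rpred1 ?rpredM ?polyOverX.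
have PN0 : P != 0.
  apply/eqP => /(congr1 (horner^~ 0)) /eqP.
  by rewrite !hornerE /= ?mul0r ?subr0 oner_eq0.
have [rs PE] := closed_field_poly_normal P.
have rsk c : c \in rs -> c \in k0.
  move=> cr; apply: (k0_closed Pk PN0); rewrite PE rootZ ?lead_coef_eq0 //.
  by rewrite root_prod_XsubC.
have mprod : m (\prod_(c <- rs) (z - c)).
  have -> : \prod_(c <- rs) (z - c) = (lead_coef P)^-1 * P.[z].
    rewrite {2}PE hornerZ mulKf ?lead_coef_eq0 // horner_prod.
    by apply: eq_bigr => c _; rewrite hornerXsubC.
  apply: mZ; first by rewrite rpredV lead_coefE; apply/polyOverP.
  by rewrite !hornerE.
apply: m1; move: rsk mprod; elim: rs {PE} => [|c rs IH] rsk; rewrite ?big_nil //.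
rewrite big_cons => mc; apply: IH => [d dr|].
  by apply: rsk; rewrite inE dr orbT.
have [q qk mq] := inv c (rsk _ (mem_head _ _)).
set r := \prod_(d <- rs) (z - d) in mc *.
have [pr prk prE] : exists2 p : {poly k}, p \is a polyOver k0 & p.[z] = r.
  exists (\prod_(d <- rs) ('X - d%:P)).
    rewrite big_seq; apply: rpred_prod => d dr.
    by rewrite polyOverXsubC rsk // inE dr orbT.
  by rewrite horner_prod; apply: eq_bigr => d _; rewrite hornerXsubC.
have -> : r = pr.[z] * (1 - (z - c) * q.[z]) + q.[z] * ((z - c) * r).
  by rewrite prE; ring.
by apply: mD; apply: mpz.
Qed.

(* Of two relations of minimal degree, the one of larger degree can be lowered
   with the help of the other. *)
Lemma maximal_inverse_relations z (p q : {poly k}) : z != 0 ->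
  (forall i, m p`_i) -> p.[z] = 1 -> (forall i, m q`_i) -> q.[z^-1] = 1 ->
  False.
Proof.
move=> z0; have [n] := ubnP (size p + size q)%N.
elim: n => // n IH in p q z z0 *; wlog pq : p q z z0 / (size q <= size p)%N.
  move=> W szn pm p1 qm q1; case: (leqP (size q) (size p)) => [le|/ltnW le].
    exact: (W p q z).
  by apply: (W q p z^-1); rewrite ?invr_eq0 ?invrK // addnC.
move=> szn pm p1 qm q1; have mm0 : m 0 by apply: (m0 (pm 0%N)).
have pN0 : (0 < size p)%N.
  rewrite lt0n size_poly_eq0; apply/eqP => p0; rewrite p0 horner0 in p1.
  by have /eqP := p1; rewrite eq_sym oner_eq0.
have qN0 : (0 < size q)%N.
  rewrite lt0n size_poly_eq0; apply/eqP => p0; rewrite p0 horner0 in q1.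
  by have /eqP := q1; rewrite eq_sym oner_eq0.
have [d szp] : exists d, size p = d.+1 by exists (size p).-1; rewrite prednK.
have u0 : 1 - q`_0 != 0 by apply: mu_neq0; apply: mN.
pose r i := q`_i / (1 - q`_0).
have rm i : m (r i) by apply: maximal_inv1D => //; apply: mN.
(* Multiplying the relation for z^-1 by z^d and dividing by 1 - q_0 expresses z^d through lower
   powers, with coefficients in [m]. Substituted into [p], this gives [p']. *)
have zd : z ^+ d = \sum_(1 <= i < d.+1) r i * z ^+ (d - i).
  have qE : q.[z^-1] = \sum_(0 <= i < d.+1) q`_i * z^-1 ^+ i.
    rewrite big_mkord; apply: horner_coef_wide.
    by rewrite -szp.
  have : 1 - q`_0 = \sum_(1 <= i < d.+1) q`_i * z^-1 ^+ i.
    by rewrite -{1}q1 qE big_nat_recl // expr0 mulr1 addrC addKr big_add1.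
  move=> /(congr1 (fun y => z ^+ d * (y / (1 - q`_0)))).
  rewrite divff // mulr1 => ->; rewrite mulr_suml mulr_sumr big_nat_cond.
  rewrite [RHS]big_nat_cond; apply: eq_bigr => i /andP[/andP[_ id] _].
  rewrite /r exprVn; have -> : z ^+ d = z ^+ (d - i) * z ^+ i.
    by rewrite -exprD subnK.
  by field; rewrite u0 expf_neq0.
pose p' := \poly_(j < d) (p`_j + p`_d * r (d - j)%N).
apply: (IH p' q z z0) => //.
- apply: leq_ltn_trans (_ : _ <= d + size q)%N _.
    by rewrite leq_add2r size_poly.
  by move: szn; rewrite szp addSn.
- move=> i; rewrite coef_poly; case: ifP => // _.
  by apply: mD => //; apply: mM.
- rewrite horner_poly -p1 (@horner_coef_wide _ d.+1) ?szp // big_ord_recr /=.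
  under eq_bigr do rewrite mulrDl.
  rewrite big_split /=; congr (_ + _).
  rewrite zd mulr_sumr big_add1 /= -(big_mkord xpredT
    (fun i => p`_d * r (d - i)%N * z ^+ i)) big_nat_rev /= add0n.
  rewrite big_nat_cond [RHS]big_nat_cond; apply: eq_bigr => i.
  rewrite andbT => /andP[_ id]; rewrite -mulrA; congr (_ * (r _ * _ ^+ _)).
  by rewrite subKn.
Qed.

(** By [maximal_inverse_relations], 1 cannot lie both in m[z] and in m[z^-1], so [maximal_extend]
    settles [z] or its inverse. *)
Lemma maximal_place : m !=set0 -> place m.
Proof.
move=> mne; split=> // z.
have [|[p [pm p1]]] := maximal_extend z mne; first by left.
have [z0|z0] := eqVneq z 0.
  left; exists 0; rewrite ?rpred0 // z0 subr0.
  by have [x /m0] := mne.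
have [Oz'|[q [qm q1]]] := maximal_extend z^-1 mne; last first.
  by case: (maximal_inverse_relations z0 pm p1 qm q1).
have [mz'|mz'] := pselect (m z^-1); first by right.
by left; have := maximal_unit Oz' mz' mne; rewrite invrK.
Qed.

End Maximal.

(** The starting point is the ideal x k0[x] of k0[x]. It omits 1, because x p(x) = 1 would make x
    algebraic over [k0]. *)
Lemma place_exists x : x \notin k0 -> exists2 m, place m & m x.
Proof.
move=> xk.
pose m0 := [set y | exists2 p : {poly k}, p \is a polyOver k0 & y = x * p.[x]].
have m0x : m0 x by exists 1; rewrite ?rpred1 // hornerE mulr1.
have [|F FP [X0 FX0] Ftot|m [m0m mP mmax]] := @Zorn_above _ nonunital m0.
- split.
  + move=> _ _ [p pk ->] [q qk ->]; exists (p + q); first by rewrite rpredD.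
    by rewrite hornerD mulrDr.
  + move=> _ _ [p pk ->] [q qk ->]; exists ('X * p * q).
      by rewrite !rpredM ?polyOverX.
    by rewrite !hornerM hornerX; ring.
  + move=> c _ ck [p pk ->]; exists (c *: p); first by rewrite polyOverZ.
    by rewrite hornerZ; ring.
  + move=> [p pk e]; case/negP: xk.
    apply: (@k0_closed ('X * p - 1)).
    * by rewrite rpredB ?rpred1 ?rpredM ?polyOverX.
    * apply/eqP => /(congr1 (horner^~ 0)) /eqP.
      by rewrite !hornerE /= ?mul0r ?sub0r oppr_eq0 oner_eq0.
    * by apply/rootP; rewrite !hornerE /= -e subrr.
- split.
  + move=> y z [Y FY Yy] [Z FZ Zz].
    have [YZ|ZY] := Ftot _ _ FY FZ.
      by exists Z => //; have [zD _ _ _] := FP _ FZ; apply: zD => //; apply: YZ.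
    by exists Y => //; have [zD _ _ _] := FP _ FY; apply: zD => //; apply: ZY.
  + move=> y z [Y FY Yy] [Z FZ Zz].
    have [YZ|ZY] := Ftot _ _ FY FZ.
      by exists Z => //; have [_ zD _ _] := FP _ FZ; apply: zD => //; apply: YZ.
    by exists Y => //; have [_ zD _ _] := FP _ FY; apply: zD => //; apply: ZY.
  + move=> c y ck [Y FY Yy]; exists Y => //.
    by have [_ _ h _] := FP _ FY; apply: h.
  + by move=> [Y FY Y1]; have [_ _ _ h] := FP _ FY; apply: h.
- exists m; last exact: m0m.
  apply: maximal_place => //; last by exists x; apply: m0m.
Qed.

End Places.

(** * Countable algebraically closed subfields *)

Section CountableClosure.
Variables (k : closedFieldType) (c : seq k).

Definition roots_of (p : {poly k}) : seq k :=
  sval (closed_field_poly_normal p).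

(** Terms for the constants, the field operations and the roots of polynomials, a root being named
    by its rank in a chosen list. The trees form a countable type, hence so do the values. *)
Fixpoint closure_eval (t : GenTree.tree nat) : k :=
  match t with
  | GenTree.Leaf n => c`_n
  | GenTree.Node 0 ts => \sum_(x <- map closure_eval ts) x
  | GenTree.Node 1 ts => \prod_(x <- map closure_eval ts) x
  | GenTree.Node 2 ts => - (map closure_eval ts)`_0
  | GenTree.Node 3 ts => ((map closure_eval ts)`_0)^-1
  | GenTree.Node n.+4 ts => (roots_of (Poly (map closure_eval ts)))`_n
  end.

Definition countable_closure : {pred k} :=
  fun x => `[< exists t, closure_eval t = x >].

Lemma countable_closureP x :
  reflect (exists t, closure_eval t = x) (x \in countable_closure).
Proof. exact: asboolP. Qed.

Lemma countable_closure_divring : divring_closed countable_closure.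
Proof.
split.
- by apply/countable_closureP; exists (GenTree.Node 1 [::]); rewrite /= big_nil.
- move=> _ _ /countable_closureP[t <-] /countable_closureP[u <-].
  apply/countable_closureP; exists (GenTree.Node 0 [:: t; GenTree.Node 2 [:: u]]).
  by rewrite /= big_cons big_seq1.
- move=> _ _ /countable_closureP[t <-] /countable_closureP[u <-].
  apply/countable_closureP; exists (GenTree.Node 1 [:: t; GenTree.Node 3 [:: u]]).
  by rewrite /= big_cons big_seq1.
Qed.

HB.instance Definition _ :=
  GRing.isDivringClosed.Build k countable_closure countable_closure_divring.

Lemma countable_closure_countable : countable [set` countable_closure].
Proof.
have -> : [set` countable_closure] = range closure_eval.
  by apply/seteqP; split=> x /= => [/countable_closureP[t <-]|[t _ <-]];
    [exists t|apply/countable_closureP; exists t].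
by apply: (sub_countable (card_image_le closure_eval setT)); apply: countableP.
Qed.

Lemma countable_closure_sub : {subset c <= countable_closure}.
Proof.
move=> x /(nthP 0)[i _ <-].
by apply/countable_closureP; exists (GenTree.Leaf i).
Qed.

Lemma countable_closure_root (p : {poly k}) x :
  p \is a polyOver countable_closure -> p != 0 -> root p x ->
  x \in countable_closure.
Proof.
move=> /polyOverP pk pN0 px.
have /choice[f fE] i : exists t, closure_eval t = p`_i.
  by apply/countable_closureP.
have xr : x \in roots_of p.
  move: px; rewrite /roots_of; case: closed_field_poly_normal => rs /= pE.
  by rewrite {1}pE rootZ ?lead_coef_eq0 // root_prod_XsubC.
apply/countable_closureP; exists (GenTree.Node (index x (roots_of p)).+4
  [seq f i | i <- iota 0 (size p)]).
rewrite /= -map_comp; under eq_map do rewrite /= fE.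
rewrite (_ : Poly _ = p) ?nth_index //.
by rewrite -[RHS]polyseqK; congr Poly; rewrite -/(mkseq _ _) mkseq_nth.
Qed.

End CountableClosure.

(** * Uncountable sets *)

Section Uncountable.
Variable T : choiceType.
Implicit Types A : set T.

Lemma uncountable_bigcup A (F : nat -> set T) :
  ~ countable A -> A `<=` \bigcup_n F n -> exists n, ~ countable (A `&` F n).
Proof.
move=> Aunc AF; apply: contrapT => /forallNP cF; apply: Aunc.
apply: (@sub_countable _ _ _ (\bigcup_n (A `&` F n))).
  by apply: subset_card_le => x Ax; have [n _ Fx] := AF _ Ax; exists n.
by apply: bigcup_countable => // n _; apply: contrapT; apply: cF.
Qed.

Lemma uncountableD A (B : set T) :
  ~ countable A -> countable B -> exists2 x, A x & ~ B x.
Proof.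
move=> Aunc Bc; apply: contrapT => h; apply: Aunc.
apply: sub_countable Bc; apply: subset_card_le => x Ax.
by apply: contrapT => Bx; apply: h; exists x.
Qed.

Lemma uncountable_uniq A n :
  ~ countable A ->
  exists s : seq T, [/\ uniq s, size s = n & {in s, forall x, A x}].
Proof.
move=> Aunc; elim: n => [|n [s [us ss sA]]]; first by exists [::].
have [x Ax xs] :=
  @uncountableD A [set` s] Aunc (finite_set_countable (finite_seq s)).
exists (x :: s); split=> /=; [|by rewrite ss|].
  by rewrite us andbT; apply/negP.
by move=> y; rewrite inE => /orP[/eqP->|/sA].
Qed.

End Uncountable.

(** * Commutative algebras of countable dimension *)

Section Ideals.
Variable R : comNzRingType.

Definition is_ideal (J : set R) : Prop :=
  [/\ J 0, forall x y, J x -> J y -> J (x + y) & forall r x, J x -> J (r * x)].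

(** [p] is maximal among the ideals that contain [N] and miss [Sg]. An element outside [p] generates
    with [p] an ideal meeting [Sg], and the product of two such elements of [Sg] gives primality. *)
Lemma prime_avoid (N Sg : set R) :
  is_ideal N -> Sg 1 -> (forall x y, Sg x -> Sg y -> Sg (x * y)) ->
  (forall x, N x -> ~ Sg x) ->
  exists p : set R, [/\ N `<=` p, is_ideal p, forall x, p x -> ~ Sg x,
    forall x, ~ p x -> exists b i, p i /\ Sg (b * x + i) &
    forall x y, p (x * y) -> p x \/ p y].
Proof.
move=> Nid S1 SM NS.
have [//||p [Np [pid pS] pmax]] :=
  @Zorn_above _ [set J : set R | is_ideal J /\ forall x, J x -> ~ Sg x] N.
  move=> F FP [X0 FX0] Ftot; split; last first.
    by move=> x [X FX Xx]; have [_] := FP _ FX; apply.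
  split.
  - by exists X0 => //; have [[h _ _] _] := FP _ FX0.
  - move=> y z [Y FY Yy] [Z FZ Zz].
    have [YZ|ZY] := Ftot _ _ FY FZ.
      exists Z => //; have [[_ h _] _] := FP _ FZ; apply: h => //; exact: YZ.
    exists Y => //; have [[_ h _] _] := FP _ FY; apply: h => //; exact: ZY.
  - by move=> r x [X FX Xx]; exists X => //; have [[_ _ h] _] := FP _ FX; apply: h.
have [p0 pD pM] := pid.
have pout x : ~ p x -> exists b i, p i /\ Sg (b * x + i).
  move=> npx; apply: contrapT => h; apply: npx.
  pose q := [set z | exists b i, p i /\ z = b * x + i].
  apply: (pmax q); last by exists 1, 0; rewrite mul1r addr0.
    by move=> z pz; exists 0, z; rewrite mul0r add0r.
  split; last by move=> z [b [i [pi ->]]] Sz; apply: h; exists b, i.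
  split.
  - by exists 0, 0; rewrite mul0r add0r.
  - move=> _ _ [b [i [pi ->]]] [c [j [pj ->]]]; exists (b + c), (i + j).
    by split; [apply: pD|ring].
  - move=> r _ [b [i [pi ->]]]; exists (r * b), (r * i).
    by split; [apply: pM|ring].
exists p; split=> // x y pxy.
have [|nx] := pselect (p x); first by left.
have [|ny] := pselect (p y); first by right.
have [b [i [pi Sb]]] := pout _ nx; have [c [j [pj Sc]]] := pout _ ny.
case: (pS _ _ (SM _ _ Sb Sc)).
have -> : (b * x + i) * (c * y + j) =
    (b * c) * (x * y) + ((c * y + j) * i + (b * x) * j) by ring.
by apply: (pD); [apply: pM|apply: (pD); apply: pM].
Qed.

End Ideals.

(** * Spans and independence modulo a subspace *)

Section LinearAlgebra.
Variable k : fieldType.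

(** Take rows from [C] with the largest possible rank; a row of [C] outside their span would raise
    it. *)
Lemma rows_span D (C : set 'rV[k]_D) :
  exists m (Q : 'M[k]_(m, D)),
    (forall i, C (row i Q)) /\ forall c, C c -> (c <= Q)%MS.
Proof.
pose P r := `[< exists m (Q : 'M[k]_(m, D)),
  (forall i, C (row i Q)) /\ \rank Q = r >].
have P0 : exists r, P r.
  exists 0%N; apply/asboolP; exists 0%N, 0; split; last by rewrite mxrank0.
  by move=> [].
have PD r : P r -> (r <= D)%N.
  by move=> /asboolP[m [Q [_ <-]]]; apply: rank_leq_col.
have [_ /asboolP[m [Q [QC <-]]] Qmax] := ex_maxnP P0 PD.
exists m, Q; split=> // c Cc; have := Qmax (\rank (col_mx Q c)).
have Pc : P (\rank (col_mx Q c)).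
  apply/asboolP; exists (m + 1)%N, (col_mx Q c); split=> // i.
  case: (split_ordP i) => j ->; first by rewrite rowKu.
  by rewrite rowKd (ord1 j) (_ : row _ _ = c) //; apply/rowP => l; rewrite mxE.
move=> /(_ Pc) le.
have sub : (Q <= col_mx Q c)%MS by rewrite -addsmxE addsmxSl.
have /eqmxP/eqmx_sym e : (Q == col_mx Q c)%MS.
  by rewrite -(geq_leqif (mxrank_leqif_eq sub)).
by rewrite -e -addsmxE addsmxSr.
Qed.

Variable L : lmodType k.
Implicit Type p : set L.

Definition is_subspace p : Prop :=
  [/\ p 0, forall x y, p x -> p y -> p (x + y) & forall c x, p x -> p (c *: x)].

Lemma subspaceN p x : is_subspace p -> p x -> p (- x).
Proof. by move=> [_ _ pZ] px; rewrite -scaleN1r; apply: pZ. Qed.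

Lemma subspaceB p x y : is_subspace p -> p x -> p y -> p (x - y).
Proof. by move=> pP px py; have [_ pD _] := pP; apply: pD => //; apply: subspaceN. Qed.

Lemma subspace_sum p I (r : seq I) (P : pred I) (F : I -> L) :
  is_subspace p -> (forall i, P i -> p (F i)) -> p (\sum_(i <- r | P i) F i).
Proof. by move=> [p0 pD _] pF; elim/big_ind: _. Qed.

Lemma independent_span (p C : set L) m (r : 'I_m -> L) : is_subspace p ->
  (forall x, C x -> exists c : 'I_m -> k, p (x - \sum_i c i *: r i)) ->
  exists m' (r' : 'I_m' -> L),
    (forall x, C x -> exists c : 'I_m' -> k, p (x - \sum_i c i *: r' i)) /\
    (forall c : 'I_m' -> k, p (\sum_i c i *: r' i) -> forall i, c i = 0).
Proof.
move=> pP; have [p0 pD pZ] := pP; elim: m r => [|m IH] r rC.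
  by exists 0%N, r; split=> // c _ [].
have [ind|] := pselect (forall c : 'I_m.+1 -> k, p (\sum_i c i *: r i) ->
    forall i, c i = 0); first by exists m.+1, r.
move=> /existsNP[c /not_implyP[pc /existsNP[j /eqP cj]]].
apply: (IH (fun i => r (lift j i))) => x /rC[d pd].
exists (fun i => d (lift j i) - d j / c j * c (lift j i)).
have := subspaceB pP pd (pZ (- (d j / c j)) _ pc).
congr p; rewrite -addrA -opprD; congr (_ - _).
rewrite !(bigD1_ord j) //= scalerDr scalerA mulNr mulfVK //.
rewrite scaler_sumr scaleNr addrACA subrr add0r -big_split /=.
by apply: eq_bigr => i _; rewrite scalerA mulNr scaleNr scalerBl.
Qed.

End LinearAlgebra.

(** * Characters of algebras of countable dimension *)

Section CountableDimension.
Variables (k : closedFieldType) (R : comAlgType k) (M : lmodType k).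
Variables (ev : {linear R -> M}) (B : {linear {poly k} -> M}).
Hypothesis k_uncountable : ~ countable [set: k].
Hypothesis evB : forall r, exists P, ev r = B P.
Hypothesis evM : forall s r, ev r = 0 -> ev (s * r) = 0.

(** The values of [ev] lie in the image of [B], so R / N has countable dimension over [k];
    polynomials serve as finite lists of coordinates. *)
Let N : set R := [set r | ev r = 0].

Lemma ann_ideal : is_ideal N.
Proof.
split=> [|x y xN yN|r x]; rewrite /N /=; first exact: linear0.
  by rewrite linearD /= xN yN addr0.
exact: evM.
Qed.

Lemma ideal_subspace (J : set R) : is_ideal J -> is_subspace J.
Proof. by move=> [J0 JD JM]; split=> // c x Jx; rewrite -mulr_algl; apply: JM. Qed.

(** Uncountably many members have coordinate polynomials of size at most one common [D], and any D +
    1 of these are dependent. *)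
Lemma dependent_family (T : choiceType) (C : set T) (b : T -> R) :
  ~ countable C -> exists n (t : 'I_n -> T) (a : 'I_n -> k),
    [/\ injective t, forall i, C (t i), exists i, a i != 0 &
        N (\sum_i a i *: b (t i))].
Proof.
move=> Cunc; have /choice[P PE] t := evB (b t).
have [||D CD] := @uncountable_bigcup _ C (fun D => [set t | (size (P t) <= D)%N]).
- exact: Cunc.
- by move=> t _; exists (size (P t)) => /=.
have [s [us ss sC]] := uncountable_uniq D.+1 CD.
have t0 : T by case: s ss {us sC}.
pose t i := nth t0 s (nat_of_ord (i : 'I_D.+1)).
have sizeP i : (size (P (t i)) <= D)%N.
  by have [] := sC (t i) (mem_nth _ _); rewrite ?ss.
pose A : 'M[k]_(D.+1, D) := \matrix_i poly_rV (P (t i)).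
have : kermx A != 0.
  rewrite -mxrank_eq0 mxrank_ker subn_eq0 -ltnNge ltnS.
  exact: rank_leq_col.
move=> /rowV0Pn[v /sub_kermxP vA v0].
exists D.+1, t, (fun i => v ord0 i); split.
- move=> i j /eqP; rewrite nth_uniq ?ss // => /eqP; exact: ord_inj.
- by move=> i; have [] := sC (t i) (mem_nth _ _); rewrite ?ss.
- apply: contrapT => /forallNP h; case/eqP: v0; apply/rowP => i.
  by rewrite mxE; have /negP := h i; rewrite negbK => /eqP.
- rewrite /N /= linear_sum /=.
  under eq_bigr do rewrite linearZ /= PE -linearZ /=.
  rewrite -linear_sum (_ : \sum_i _ = 0) ?linear0 //.
  transitivity (rVpoly (v *m A)); last by rewrite vA linear0.
  rewrite mulmx_sum_row linear_sum; apply: eq_bigr => i _.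
  by rewrite linearZ /= rowK poly_rV_K.
Qed.

(* The elements 1 / (x - c) of a field are linearly independent when x is
   transcendental over k. *)
Lemma many_inverses (J : set R) (x : R) (C : set k) :
  is_ideal J -> N `<=` J -> ~ countable C ->
  (forall c, C c -> exists b, J ((x - c%:A) * b - 1)) ->
  exists2 Q : {poly k}, Q != 0 & J (horner_alg x Q).
Proof.
move=> Jid NJ Cunc inv; have [J0 JD JM] := Jid.
have /choice[b bP] c : exists b, C c -> J ((x - c%:A) * b - 1).
  have [/inv[b bJ]|] := pselect (C c); first by exists b.
  by exists 0.
have [n [t [a [tinj tC [i0 ai0] dep]]]] := dependent_family b Cunc.
(* Clearing denominators in the sum of the a_i / (x - t_i) gives the required polynomial; it is
   nonzero at t_(i0), where only one term survives. *)
pose pr i : {poly k} := \prod_(j | j != i) ('X - (t j)%:P).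
exists (\sum_i a i *: pr i).
  apply/eqP => /(congr1 (horner^~ (t i0))); rewrite horner0 horner_sum.
  rewrite (bigD1 i0) //= big1 => [|j ji0].
    rewrite addr0 hornerZ horner_prod => /eqP; rewrite mulf_eq0 (negPf ai0) /=.
    apply/negP; rewrite prodf_seq_neq0; apply/allP => j _; apply/implyP => ji.
    by rewrite hornerXsubC subr_eq0 (inj_eq tinj) eq_sym.
  rewrite hornerZ horner_prod (bigD1 i0) 1?eq_sym //= hornerXsubC subrr.
  by rewrite mul0r mulr0.
pose al := \prod_i (x - (t i)%:A).
have prE i : al = (x - (t i)%:A) * horner_alg x (pr i).
  rewrite /al (bigD1 i) //=; congr (_ * _); rewrite rmorph_prod.
  by apply: eq_bigr => j _; rewrite rmorphB /= horner_algX horner_algC.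
have -> : horner_alg x (\sum_i a i *: pr i) = al * (\sum_i a i *: b (t i)) +
    \sum_i (- (a i *: horner_alg x (pr i))) * ((x - (t i)%:A) * b (t i) - 1).
  rewrite linear_sum mulr_sumr -big_split; apply: eq_bigr => i _ /=.
  rewrite linearZ /= {1}(prE i) -!scalerAr -!scalerAl mulNr -scalerAl.
  by rewrite -scalerBr; congr (_ *: _); ring.
apply: (JD); first by apply: (JM); apply: NJ.
apply: (subspace_sum _ (ideal_subspace Jid)) => i _.
by apply: (JM); apply: bP.
Qed.

Definition is_character (J : set R) (chi : R -> k) : Prop :=
  [/\ forall x y, chi (x + y) = chi x + chi y,
      forall x y, chi (x * y) = chi x * chi y,
      forall c, chi c%:A = c & forall x, J x -> chi x = 0].

(** Let [m] be a maximal ideal containing [J]. If [x] were congruent to no scalar, every x - c would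
    be invertible modulo [m], so [many_inverses] would give Q(x) in [m] with Q nonzero; splitting Q
    over [k] puts some x - c in [m]. *)
Lemma nullstellensatz (J : set R) : is_ideal J -> N `<=` J -> ~ J 1 ->
  exists chi, is_character J chi.
Proof.
move=> Jid NJ J1.
(* Avoiding the multiplicative set reduced to 1 means being a proper ideal, so [m] is a maximal
   ideal. *)
have [||x Jx x1|m [Jm mid m1 mmax mprime]] := @prime_avoid R J [set 1] Jid.
- by [].
- by move=> x y -> ->; rewrite mulr1.
- by apply: J1; rewrite -x1.
have [m0 mD mM] := mid; have mS := ideal_subspace mid.
have {}m1 : ~ m 1 by move=> /m1; apply.
have scal x : exists c, m (x - c%:A).
  apply: contrapT => /forallNP nx.
  have [|||Q Q0 mQ] := @many_inverses m x setT mid.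
  - exact: subset_trans Jm.
  - exact: k_uncountable.
  - move=> c _; have [b [i [mi bi]]] := mmax _ (nx c); exists b.
    have -> : (x - c%:A) * b - 1 = - i + (b * (x - c%:A) + i - 1) by ring.
    by rewrite bi subrr addr0; apply: subspaceN.
  have [rs QE] := closed_field_poly_normal Q.
  move: mQ; rewrite QE linearZ /= => /(mM (lead_coef Q)^-1%:A).
  rewrite !mulr_algl scalerA mulVf ?lead_coef_eq0 // scale1r rmorph_prod /=.
  elim: (rs) => [|c s IH]; rewrite ?big_nil // big_cons => /mprime[|/IH//].
  by rewrite rmorphB /= horner_algX horner_algC; apply: nx.
have uniq_c c d : m (c%:A - d%:A) -> c = d.
  move=> mcd; apply/eqP; rewrite -subr_eq0; apply/negP => /negP cd.
  apply: m1; have := mM (c - d)^-1%:A _ mcd.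
  by rewrite -scalerBl mulr_algl scalerA mulVf // scale1r.
have [chi chiP] := choice scal.
exists chi; split=> [x y|x y|c|x Jx]; apply: uniq_c.
- rewrite (_ : _ - _ = (x - (chi x)%:A) + (y - (chi y)%:A)
      - (x + y - (chi (x + y))%:A)).
    by apply: (subspaceB mS) => //; apply: mD.
  by rewrite scalerDl; ring.
- rewrite (_ : _ - _ = y * (x - (chi x)%:A) + (chi x)%:A * (y - (chi y)%:A)
      - (x * y - (chi (x * y))%:A)).
    by apply: (subspaceB mS) => //; apply: mD; apply: mM.
  by rewrite -scalerA -[_ *: (_ *: 1)]mulr_algl; ring.
- by rewrite -opprB; apply: (subspaceN mS).
- rewrite scale0r subr0 -[_%:A](subKr x); apply: (subspaceB mS) => //.
  exact: Jm.
Qed.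

(** [S] collects the members of [S0] whose coordinate rows lie in a subspace [K] of least dimension
    among those capturing uncountably many. If uncountably many members of [S] fall in [W], their
    rows span [K] by minimality, so [W] contains all of [S]. *)
Lemma minimal_uncountable (T : choiceType) (e : T -> R) (S0 : set T) D :
  ~ countable S0 ->
  (forall h, S0 h -> exists2 P : {poly k}, (size P <= D)%N & ev (e h) = B P) ->
  exists S, [/\ S `<=` S0, ~ countable S &
    forall W : set R, is_subspace W -> N `<=` W ->
      ~ countable (S `&` [set h | W (e h)]) -> S `<=` [set h | W (e h)]].
Proof.
move=> S0unc S0D.
have /choice[a aP] h : exists a : 'rV[k]_D, S0 h -> ev (e h) = B (rVpoly a).
  have [/S0D[P PD PE]|] := pselect (S0 h); last by exists 0.
  by exists (poly_rV P); rewrite poly_rV_K.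
pose SK (K : 'M[k]_D) := S0 `&` [set h | (a h <= K)%MS].
pose P r := `[< exists2 K : 'M[k]_D, \rank K = r & ~ countable (SK K) >].
have P0 : exists r, P r.
  exists (\rank (1%:M : 'M[k]_D)); apply/asboolP; exists 1%:M => //.
  apply: contra_not S0unc; apply: sub_countable; apply: subset_card_le => h S0h.
  by split=> //=; apply: submx1.
have [_ /asboolP[K <- Kunc] Kmin] := ex_minnP P0.
exists (SK K); split=> // [h []//|W Wsub NW Wunc h [S0h /= hK]].
have [m [Q [QC QW]]] :=
  rows_span [set a h | h in SK K `&` [set h | W (e h)]].
have QK : (Q <= K)%MS.
  by apply/row_subP => i; have [h' [[_ /= ?] _] <-] := QC i.
have KQ : (K <= Q)%MS.
  rewrite -(geq_leqif (mxrank_leqif_sup QK)) -(mxrank_gen Q).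
  apply: Kmin; apply/asboolP; exists <<Q>>%MS => //.
  apply: contra_not Wunc; apply: sub_countable; apply: subset_card_le.
  move=> h' h'W; split; first by case: h'W => -[].
  by rewrite /= genmxE; apply: QW; exists h'.
have /submxP[v vE] := submx_trans hK KQ.
have /choice[g gP] i :
    exists h', (SK K `&` [set h | W (e h)]) h' /\ a h' = row i Q.
  by have [h' ? ?] := QC i; exists h'.
have [_ WD WZ] := Wsub.
rewrite /= -(subrK (\sum_i v ord0 i *: e (g i)) (e h)).
apply: (WD); last first.
  by apply: subspace_sum => // i _; apply: WZ; have [[_]] := gP i.
apply: NW; rewrite /N /= raddfB /= aP // vE mulmx_sum_row !linear_sum /=.
rewrite -big_split /=.
apply: big1 => i _; rewrite !linearZ /=; have [[[S0g _] _] <-] := gP i.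
by rewrite -aP // scalerN subrr.
Qed.

Lemma finite_span (T : choiceType) (e : T -> R) (S : set T) D :
  (forall h, S h -> exists2 P : {poly k}, (size P <= D)%N & ev (e h) = B P) ->
  exists m (r : 'I_m -> R), forall x, (e @` S) x ->
    exists c : 'I_m -> k, N (x - \sum_i c i *: r i).
Proof.
move=> SD.
have /choice[a aP] h : exists a : 'rV[k]_D, S h -> ev (e h) = B (rVpoly a).
  have [/SD[P PD PE]|] := pselect (S h); last by exists 0.
  by exists (poly_rV P); rewrite poly_rV_K.
have [m [Q [QC QW]]] := rows_span [set a h | h in S].
have /choice[g gP] i : exists h', S h' /\ a h' = row i Q.
  by have [h' ? ?] := QC i; exists h'.
exists m, (e \o g) => _ [h Sh <-].
have /submxP[v vE] := QW (a h) (ex_intro2 _ _ h Sh erefl).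
exists (fun i => v ord0 i); rewrite /N /= raddfB /= aP // vE.
rewrite mulmx_sum_row !linear_sum /= -big_split /=.
apply: big1 => i _; rewrite !linearZ /=; have [Sg <-] := gP i.
by rewrite -aP // scalerN subrr.
Qed.

End CountableDimension.

(** * Arithmetic of a place *)

Section PlaceTheory.
Variables (k : closedFieldType) (k0 : divringClosed k) (m : set k).
Hypothesis mP : place k0 m.

Definition place_ring : set k := [set z | exists2 c, c \in k0 & m (z - c)].

Let mD := let: conj (And4 h _ _ _) _ := mP in h.
Let mM := let: conj (And4 _ h _ _) _ := mP in h.
Let mZ := let: conj (And4 _ _ h _) _ := mP in h.
Let m1 := let: conj (And4 _ _ _ h) _ := mP in h.

Lemma place_subspace_mul z x : place_ring z -> m x -> m (z * x).
Proof.
move=> [c ck mc] mx; rewrite -[z](subrK c) mulrDl.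
by apply: mD; [apply: mM|apply: mZ].
Qed.

Lemma place0 : m 0.
Proof.
have [_ h] := mP; have [[c ck mc]|[_ mc]] := h 0.
  by rewrite -(mul0r (0 - c)); apply: mZ; rewrite ?rpred0.
by rewrite -(mul0r 0^-1); apply: mZ; rewrite ?rpred0.
Qed.

Lemma placeN x : m x -> m (- x).
Proof. by move=> mx; rewrite -mulN1r; apply: mZ; rewrite ?rpredN ?rpred1. Qed.

Lemma place_sum I (r : seq I) (P : pred I) (F : I -> k) :
  (forall i, P i -> m (F i)) -> m (\sum_(i <- r | P i) F i).
Proof. by move=> mF; elim/big_ind: _ => //; apply: place0. Qed.

Lemma place_ring_sub z : z \in k0 -> place_ring z.
Proof. by move=> zk; exists z; rewrite // subrr; apply: place0. Qed.

Lemma place_ring_ideal z : m z -> place_ring z.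
Proof. by move=> mz; exists 0; rewrite ?rpred0 ?subr0. Qed.

Lemma place_ringM y z : place_ring y -> place_ring z -> place_ring (y * z).
Proof.
move=> Oy Oz; have [c ck mc] := Oy; have [d dk md] := Oz.
exists (c * d); first by rewrite rpredM.
have -> : y * z - c * d = y * (z - d) + d * (y - c) by ring.
by apply: mD; apply: place_subspace_mul => //; apply: place_ring_sub.
Qed.

Lemma place_field z : m z -> z \in k0 -> z = 0.
Proof.
move=> mz zk; apply/eqP; apply/negP => /negP z0; apply: m1.
by rewrite -(mulVf z0); apply: mZ; rewrite ?rpredV.
Qed.

(** Divisibility in a valuation ring is total, so one nonzero entry divides all the others. Dividing
    by it makes a vector reducible at the place, with a residue 1 at [i0]. *)
Lemma place_leading n (d : 'I_n -> k) : (exists i, d i != 0) ->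
  exists2 i0, d i0 != 0 & forall i, place_ring (d i / d i0).
Proof.
move=> [j dj].
suff H (s : seq 'I_n) : exists2 i0, d i0 != 0 &
    forall i, i \in j :: s -> place_ring (d i / d i0).
  have [i0 h Hi] := H (enum 'I_n); exists i0 => // i; apply: Hi.
  by rewrite inE mem_enum orbT.
have O1 : place_ring 1 by apply: place_ring_sub; rewrite rpred1.
elim: s => [|i s [i0 d0 IH]].
  by exists j => // i; rewrite inE => /eqP ->; rewrite divff.
have [_ /(_ (d i / d i0))[Oz|[z0 mz]]] := mP.
  exists i0 => // l; rewrite !inE orbCA -in_cons => /orP[/eqP->//|]; exact: IH.
have di : d i != 0 by move: z0; rewrite mulf_eq0 negb_or => /andP[].
exists i => // l; rewrite !inE orbCA -in_cons => /orP[/eqP->|/IH Ol].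
  by rewrite divff.
have -> : d l / d i = (d l / d i0) * (d i / d i0)^-1 by field; rewrite d0 di.
by apply: place_ringM => //; apply: place_ring_ideal.
Qed.

End PlaceTheory.

(** * Uncountable groups of units contain algebraic elements *)

Section UncountableUnits.
Variables (k : closedFieldType) (R : comAlgType k) (M : lmodType k).
Variables (ev : {linear R -> M}) (B : {linear {poly k} -> M}).
Hypothesis k_uncountable : ~ countable [set: k].
Hypothesis evB : forall r, exists P, ev r = B P.
Hypothesis evM : forall s r, ev r = 0 -> ev (s * r) = 0.

Let N : set R := [set r | ev r = 0].

Lemma character_sum (J : set R) chi n (c : 'I_n -> k) (r : 'I_n -> R) :
  is_character J chi -> chi (\sum_i c i *: r i) = \sum_i c i * chi (r i).
Proof.
move=> [cD cM cC cJ].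
have c0 : chi 0 = 0 by rewrite -(scale0r 1) cC.
rewrite (big_morph chi cD c0); apply: eq_bigr => i _.
by rewrite -mulr_algl cM cC.
Qed.

(** Only countably many u - c are invertible modulo [p], by [many_inverses]. For any other c the
    ideal generated by [p] and u - c is proper, and [nullstellensatz] gives a character with value c
    at [u]; two such c suffice. *)
Lemma two_characters (p : set R) u : is_ideal p -> N `<=` p ->
  (forall Q : {poly k}, Q != 0 -> ~ p (horner_alg u Q)) ->
  exists chi1 chi2, [/\ is_character p chi1, is_character p chi2 &
    chi1 u <> chi2 u].
Proof.
move=> pid Np ptr; have [p0 pD pM] := pid.
pose C := [set c : k | exists b, p ((u - c%:A) * b - 1)].
have Cc : countable C.
  apply: contrapT => Cunc.
  have [|Q Q0 pQ] := many_inverses (x := u) evB pid Np Cunc; first by [].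
  exact: (ptr Q).
have ch c : ~ C c -> exists2 chi, is_character p chi & chi u = c.
  move=> nC; pose J := [set x | exists i b, p i /\ x = i + (u - c%:A) * b].
  have pJ : p `<=` J by move=> x px; exists x, 0; rewrite mulr0 addr0.
  have Jid : is_ideal J.
    split; first exact: pJ.
    - move=> _ _ [i [b [pi ->]]] [j [d [pj ->]]]; exists (i + j), (b + d).
      by split; [apply: pD|ring].
    - move=> r _ [i [b [pi ->]]]; exists (r * i), (r * b).
      by split; [apply: pM|ring].
  have [||chi [cD cM cC cJ]] := nullstellensatz k_uncountable evB Jid.
  - exact: subset_trans pJ.
  - move=> [i [b [pi e]]]; apply: nC; exists b.
    set X := (u - c%:A) * b in e *.
    have -> : X - 1 = - i by rewrite e; ring.
    by rewrite -mulN1r; apply: pM.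
  exists chi; first by split=> // x /pJ; apply: cJ.
  apply/eqP; rewrite -subr_eq0; apply/eqP.
  have /cJ <- : J (u - c%:A) by exists 0, 1; rewrite mulr1 add0r.
  by rewrite -scaleNr cD cC.
have [c1 _ nC1] := uncountableD k_uncountable Cc.
have Cc' : countable (C `|` [set c1]).
  rewrite -bigcup2E; apply: bigcup_countable => // -[|[|i]] _ //=.
have [c2 _ nC2] := uncountableD k_uncountable Cc'.
have [|chi1 h1 e1] := ch c1; first by [].
have [|chi2 h2 e2] := ch c2; first by move=> h; apply: nC2; left.
exists chi1, chi2; split=> //; rewrite e1 e2 => h.
by apply: nC2; right.
Qed.

Lemma bilinear_expand a b c (r : 'I_a -> R) (r' : 'I_b -> R) (w : 'I_c -> R)
    (g : 'I_a -> 'I_b -> 'I_c -> k) (d : 'I_a -> k) (d' : 'I_b -> k) :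
  \sum_i \sum_j (d i * d' j) *: (r i * r' j - \sum_l g i j l *: w l) =
  (\sum_i d i *: r i) * (\sum_j d' j *: r' j)
    - \sum_l (\sum_i \sum_j d i * d' j * g i j l) *: w l.
Proof.
have -> : \sum_l (\sum_i \sum_j d i * d' j * g i j l) *: w l =
    \sum_i \sum_j \sum_l (d i * d' j * g i j l) *: w l.
  under eq_bigr do rewrite scaler_suml.
  rewrite exchange_big; apply: eq_bigr => i _ /=.
  under eq_bigr do rewrite scaler_suml.
  by rewrite exchange_big.
rewrite mulr_suml -sumrB; apply: eq_bigr => i _.
rewrite mulr_sumr -sumrB; apply: eq_bigr => j _.
rewrite scalerBr -scalerAl -scalerAr scalerA scaler_sumr.
by congr (_ - _); apply: eq_bigr => l _; rewrite scalerA.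
Qed.

(* A unit s = sum_i d_i r_i with inverse sum_j d'_j r'_j, both in finite
   dimensional spaces modulo a prime p defined over k0, cannot have a
   transcendental ratio of values at two points: at a place where chi1 s / chi2 s
   vanishes the rescaled s and s^-1 would reduce to zero divisors. *)
Lemma character_ratio (k0 : divringClosed k) (p : set R) (s s' : R)
    (chi1 chi2 : R -> k) a b c (r : 'I_a -> R) (r' : 'I_b -> R) (w : 'I_c -> R)
    (g : 'I_a -> 'I_b -> 'I_c -> k) (ep : 'I_c -> k)
    (d : 'I_a -> k) (d' : 'I_b -> k) :
  (forall (q : {poly k}) x,
     q \is a polyOver k0 -> q != 0 -> root q x -> x \in k0) ->
  is_ideal p -> ~ p 1 -> (forall x y, p (x * y) -> p x \/ p y) ->
  is_character p chi1 -> is_character p chi2 ->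
  s * s' = 1 ->
  p (s - \sum_i d i *: r i) -> p (s' - \sum_j d' j *: r' j) ->
  (forall i j, p (r i * r' j - \sum_l g i j l *: w l)) ->
  p (1 - \sum_l ep l *: w l) ->
  (forall e : 'I_a -> k, p (\sum_i e i *: r i) -> forall i, e i = 0) ->
  (forall e : 'I_b -> k, p (\sum_i e i *: r' i) -> forall i, e i = 0) ->
  (forall e : 'I_c -> k, p (\sum_i e i *: w i) -> forall i, e i = 0) ->
  (forall i j l, g i j l \in k0) -> (forall l, ep l \in k0) ->
  (forall i, chi1 (r i) \in k0) -> (forall i, chi2 (r i) \in k0) ->
  (forall i, chi1 (r' i) \in k0) ->
  chi1 s / chi2 s \in k0.
Proof.
move=> k0_closed pid p1 pprime ch1 ch2 ss' sE s'E gE epE rind r'ind wind.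
move=> gk epk c1r c2r c1r'; apply/negPn/negP => /(place_exists k0_closed)[m mP mx].
have [p0 pD pM] := pid; have pS := ideal_subspace pid.
have [[mD mM mZ m1] mtot] := mP.
have chE chi n (e : 'I_n -> k) (t : 'I_n -> R) x : is_character p chi ->
    p (x - \sum_i e i *: t i) -> chi x = \sum_i e i * chi (t i).
  move=> ch px; rewrite -(character_sum _ _ ch).
  have [cD _ _ cJ] := ch; rewrite -[x in LHS](subrK (\sum_i e i *: t i)).
  by rewrite cD (cJ _ px) add0r.
have unit_out x y : x * y = 1 -> ~ p x.
  by move=> xy px; apply: p1; rewrite -xy mulrC; apply: pM.
have lead n (e : 'I_n -> k) (t : 'I_n -> R) x :
    ~ p x -> p (x - \sum_i e i *: t i) -> exists i, e i != 0.
  move=> npx pxe; apply: contrapT => /forallNP e0; apply: npx.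
  move: pxe; rewrite big1 ?subr0 // => i _.
  by have /negP := e0 i; rewrite negbK => /eqP ->; rewrite scale0r.
have [i0 di0 dO] := place_leading mP (lead _ _ _ _ (unit_out _ _ ss') sE).
have s's : s' * s = 1 by rewrite mulrC.
have [j0 dj0 d'O] := place_leading mP (lead _ _ _ _ (unit_out _ _ s's) s'E).
set A := d i0 in di0 dO; set A' := d' j0 in dj0 d'O.
(* [e] and [e'] are the coordinates of s / A and s' / A', which are integral at the place; [f] and
   [f'] are their residues in [k0], equal to 1 at [i0] and [j0]. *)
pose e i := d i / A; pose e' j := d' j / A'.
have /choice[f fP] i : exists f, f \in k0 /\ m (e i - f).
  by have [f ? ?] := dO i; exists f.
have /choice[f' f'P] j : exists f, f \in k0 /\ m (e' j - f).
  by have [f' ? ?] := d'O j; exists f'.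
have res_neq0 n (h : 'I_n -> k) (t : 'I_n -> R) (i : 'I_n) (z : k) :
    (forall c : 'I_n -> k, p (\sum_i c i *: t i) -> forall i, c i = 0) ->
    z != 0 -> m (z / z - h i) -> ~ p (\sum_i h i *: t i).
  move=> tind z0; rewrite divff // => mh /tind h0; apply: m1.
  by move: mh; rewrite h0 subr0.
have np_v : ~ p (\sum_i f i *: r i).
  by apply: (res_neq0 _ _ _ i0 A) => //; have [] := fP i0.
have np_v' : ~ p (\sum_j f' j *: r' j).
  by apply: (res_neq0 _ _ _ j0 A') => //; have [] := f'P j0.
have sumO n (x h : 'I_n -> k) : (forall i, place_ring k0 m (x i)) ->
    (forall i, h i \in k0) -> place_ring k0 m (\sum_i x i * h i).
  move=> xO hk; have /choice[y yP] i : exists y, y \in k0 /\ m (x i - y).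
    by have [y ? ?] := xO i; exists y.
  exists (\sum_i y i * h i).
    by apply: rpred_sum => i _; rewrite rpredM //; have [] := yP i.
  rewrite -sumrB; apply: (place_sum mP) => i _.
  by rewrite -mulrBl mulrC; apply: mZ => //; have [] := yP i.
have c1s : chi1 s = A * \sum_i e i * chi1 (r i).
  rewrite (chE _ _ _ _ _ ch1 sE) mulr_sumr; apply: eq_bigr => i _.
  by rewrite mulrA mulrCA divff ?mulr1.
have c2s : chi2 s = A * \sum_i e i * chi2 (r i).
  rewrite (chE _ _ _ _ _ ch2 sE) mulr_sumr; apply: eq_bigr => i _.
  by rewrite mulrA mulrCA divff ?mulr1.
have c1s' : chi1 s' = A' * \sum_j e' j * chi1 (r' j).
  rewrite (chE _ _ _ _ _ ch1 s'E) mulr_sumr; apply: eq_bigr => i _.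
  by rewrite mulrA mulrCA divff ?mulr1.
have chu chi : is_character p chi -> chi s * chi s' = 1.
  by move=> [_ cM cC _]; rewrite -cM ss' -[1]scale1r cC.
(* The value of [chi2] at s / A is integral and the ratio chi1 s / chi2 s vanishes at the place, so
   [chi1] of s / A vanishes there too. *)
have m_v : m (\sum_i e i * chi1 (r i)).
  have c2s0 : chi2 s != 0.
    apply/eqP => h; have /eqP := chu _ ch2; rewrite h mul0r eq_sym.
    by rewrite oner_eq0.
  have -> : \sum_i e i * chi1 (r i) =
      (\sum_i e i * chi2 (r i)) * (chi1 s / chi2 s).
    rewrite c1s; move: c2s0; rewrite c2s mulf_eq0 negb_or => /andP[_ h].
    by field; rewrite di0 h.
  by apply: (place_subspace_mul mP) => //; apply: sumO.
have m_inv : m (A * A')^-1.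
  have -> : (A * A')^-1 =
      (\sum_j e' j * chi1 (r' j)) * (\sum_i e i * chi1 (r i)).
    have := chu _ ch1; rewrite c1s c1s' => h.
    by apply: (mulfI (mulf_neq0 di0 dj0)); rewrite divff ?mulf_neq0 // -h; ring.
  by apply: (place_subspace_mul mP) => //; apply: sumO.
(* The coordinates on [w] of the product of s / A and s' / A' are those of 1 divided by A A', hence
   lie in [m]. Their residues [F] are therefore 0, and the two reductions multiply into [p]. *)
pose T l := \sum_i \sum_j e i * e' j * g i j l.
have TE l : T l = ep l * (A * A')^-1.
  pose D l := \sum_i \sum_j d i * d' j * g i j l.
  have DE : D l = ep l.
    apply/eqP; rewrite -subr_eq0; apply/eqP; move: l.
    apply: wind.
    have -> : \sum_l (D l - ep l) *: w l = (1 - \sum_l ep l *: w l)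
        - \sum_i \sum_j (d i * d' j) *: (r i * r' j - \sum_l g i j l *: w l)
        - (\sum_j d' j *: r' j) * (s - \sum_i d i *: r i)
        - s * (s' - \sum_j d' j *: r' j).
      under eq_bigr do rewrite scalerBl; rewrite sumrB.
      rewrite bilinear_expand -/(D _).
      by rewrite -[1]ss'; ring.
    apply: (subspaceB pS); last exact: (pM).
    apply: (subspaceB pS); last exact: (pM).
    apply: (subspaceB pS) => //.
    apply: (subspace_sum _ pS) => i _; apply: (subspace_sum _ pS) => j _.
    by have [_ _ pZ] := pS; apply: pZ.
  rewrite -DE /T /D mulr_suml; apply: eq_bigr => i _.
  rewrite mulr_suml; apply: eq_bigr => j _; rewrite /e /e' invfM; ring.
pose F l := \sum_i \sum_j f i * f' j * g i j l.
have F0 l : F l = 0.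
  apply: (place_field mP); last first.
    apply: rpred_sum => i _; apply: rpred_sum => j _.
    by have [? _] := fP i; have [? _] := f'P j; rewrite !rpredM.
  have -> : F l = T l - (T l - F l) by ring.
  apply: (mD); first by rewrite TE; apply: (mZ).
  apply: (placeN mP); rewrite /T /F -sumrB; apply: (place_sum mP) => i _.
  rewrite -sumrB; apply: (place_sum mP) => j _.
  have [fk mf] := fP i; have [f'k mf'] := f'P j.
  have -> : e i * e' j * g i j l - f i * f' j * g i j l =
     g i j l * (f' j * (e i - f i) + e i * (e' j - f' j)) by ring.
  apply: (mZ) => //; apply: (mD); first exact: (mZ).
  by apply: (place_subspace_mul mP) => //; apply: dO.
have : p ((\sum_i f i *: r i) * (\sum_j f' j *: r' j)).
  have -> : (\sum_i f i *: r i) * (\sum_j f' j *: r' j) =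
     \sum_i \sum_j (f i * f' j) *: (r i * r' j - \sum_l g i j l *: w l).
    rewrite bilinear_expand -/(F _) [X in _ - X]big1 ?subr0 // => l _.
    by rewrite -/(F l) F0 scale0r.
  apply: (subspace_sum _ pS) => i _; apply: (subspace_sum _ pS) => j _.
  by have [_ _ pZ] := pS; apply: pZ.
by move=> /pprime[].
Qed.

(** Without an algebraic element, one works modulo a prime that keeps a difference [u] of two
    members of a minimal uncountable family transcendental. Two characters separating [u] then have
    a ratio outside a countable field on some member, against [character_ratio]. *)
Theorem algebraic_element (H : zmodType) (e : H -> R) :
  ~ countable [set: H] -> e 0 = 1 -> (forall s t, e (s + t) = e s * e t) ->
  exists h (q : {poly k}), [/\ h != 0, q != 0 & ev (horner_alg (e h) q) = 0].
Proof.
move=> Hunc e0 eD; apply: contrapT => nalg.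
have eV h : e h * e (- h) = 1 by rewrite -eD subrr.
pose bounded D (r : R) := exists2 P : {poly k}, (size P <= D)%N & ev r = B P.
have [//||D S0unc] := @uncountable_bigcup _ [set: H]
    (fun D => [set h | bounded D (e h) /\ bounded D (e (- h))]).
  move=> h _; have [P PE] := evB (e h); have [Q QE] := evB (e (- h)).
  exists (maxn (size P) (size Q)) => //; split; [exists P|exists Q] => //.
    exact: leq_maxl.
  exact: leq_maxr.
have [|S [SS0 Sunc Smin]] := @minimal_uncountable _ _ _ ev B _ e _ D S0unc.
  by move=> h [_ []].
have Sb h : S h -> bounded D (e h) by move=> /SS0[_ []].
have Sb' h : S h -> bounded D (e (- h)) by move=> /SS0[_ []].
have [a0 [r0 r0P]] := finite_span Sb.
have [b0 [r0' r0'P]] := finite_span Sb'.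
have Nid := ann_ideal evM.
have [s0 [t0 [Ss0 St0 st0]]] : exists s t, [/\ S s, S t & s != t].
  have [s [us ss sS]] := uncountable_uniq 2 Sunc.
  case: s us ss sS => [//|x [//|y [|//]]] /=; rewrite inE andbT => xy _ sS.
  by exists x, y; split=> //; apply: sS; rewrite !inE eqxx ?orbT.
pose u := e (s0 - t0).
(* Avoiding all nonzero polynomials in [u] keeps [u] transcendental modulo [p]. *)
pose Sg := [set r | exists2 Q : {poly k}, Q != 0 & r = horner_alg u Q].
have [||x Nx [Q Q0 xE]|p [Np pid pS _ pprime]] := @prime_avoid R N Sg Nid.
- by exists 1; rewrite ?oner_neq0 ?rmorph1.
- by move=> _ _ [P P0 ->] [Q Q0 ->]; exists (P * Q); rewrite ?mulf_neq0 ?rmorphM.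
- apply: nalg; exists (s0 - t0), Q; rewrite subr_eq0; split=> //.
  by rewrite -/u -xE.
have p1 : ~ p 1 by move=> /pS; apply; exists 1; rewrite ?oner_neq0 ?rmorph1.
have [Q Q0 pQ|chi1 [chi2 [ch1 ch2 neq]]] := @two_characters p u pid Np.
  by apply: (pS _ pQ); exists Q.
have pSub := ideal_subspace pid.
have [a [r [rP rind]]] := independent_span (p := p) (C := e @` S) (r := r0) pSub
  (fun x Cx => let: ex_intro c Nc := r0P x Cx in ex_intro _ c (Np _ Nc)).
have [b [r' [r'P r'ind]]] :=
  independent_span (p := p) (C := (e \o -%R) @` S) (r := r0') pSub
  (fun x Cx => let: ex_intro c Nc := r0'P x Cx in ex_intro _ c (Np _ Nc)).
pose prods := [set x | x = 1 \/ exists i j, x = r i * r' j].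
pose lst : seq R := 1 :: [seq r ij.1 * r' ij.2 | ij : 'I_a * 'I_b].
have prods_span x : prods x -> exists c : 'I_(size lst) -> k,
    p (x - \sum_i c i *: lst`_i).
  move=> px; have xl : x \in lst.
    case: px => [->|[i [j ->]]]; first exact: mem_head.
    by rewrite inE; apply/orP; right; apply/mapP; exists (i, j); rewrite ?mem_enum.
  have lti : (index x lst < size lst)%N by rewrite index_mem.
  exists (fun i => (i == Ordinal lti)%:R).
  rewrite (bigD1 (Ordinal lti)) //= eqxx scale1r nth_index // big1 ?addr0.
    by rewrite subrr; case: pid.
  by move=> i /negPf ->; rewrite scale0r.
have [c [w [wP wind]]] := independent_span pSub prods_span.
have [ep epP] := wP 1 (or_introl erefl).
have /choice[g gP] ij : exists g : 'I_c -> k,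
    p (r ij.1 * r' ij.2 - \sum_l g l *: w l).
  by apply: wP; right; exists ij.1, ij.2.
(* These are the structure constants, the coordinates of 1 and the values of the characters on the
   bases: everything that has to be defined over [k0]. *)
pose cst : seq k := [seq g x.1 x.2 | x : 'I_a * 'I_b * 'I_c] ++ codom ep ++
  codom (chi1 \o r) ++ codom (chi2 \o r) ++ codom (chi1 \o r').
have ck := @countable_closure_sub k cst.
have chi_unit chi h : is_character p chi -> chi (e h) != 0.
  move=> [_ cM cC _]; apply/eqP => h0.
  have := cM (e h) (e (- h)); rewrite eV h0 mul0r -[1]scale1r cC => /eqP.
  by rewrite oner_eq0.
have chi_N chi : is_character p chi -> forall x, N x -> chi x = 0.
  by move=> [_ _ _ cJ] x /Np /cJ.
(* If all the ratios lay in the countable field, one ratio x would occur uncountably often, hence on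
   all of [S] by minimality; then chi1 u = chi2 u. *)
have [s Ss sr] : exists2 s, S s &
    chi1 (e s) / chi2 (e s) \notin countable_closure cst.
  apply: contrapT => h; apply: Sunc.
  apply: (@sub_countable _ _ _ (\bigcup_(x in [set` countable_closure cst])
     (S `&` [set t | chi1 (e t) = x * chi2 (e t)]))).
    apply: subset_card_le => t St; exists (chi1 (e t) / chi2 (e t)).
      by apply: contrapT => tk; apply: h; exists t => //; apply/negP.
    by split=> //=; rewrite divfK ?chi_unit.
  apply: bigcup_countable; first exact: countable_closure_countable.
  move=> x _; apply: contrapT => unc.
  have [cD cM cC cJ] := ch1; have [dD dM dC dJ] := ch2.
  have sub := Smin [set y | chi1 y = x * chi2 y].
  have {sub} /(_ unc) sub :
      ~ countable (S `&` [set t | chi1 (e t) = x * chi2 (e t)])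
      -> S `<=` [set t | chi1 (e t) = x * chi2 (e t)].
    apply: sub; last by move=> y Ny /=; rewrite !chi_N ?mulr0.
    split=> /= [|y z yE zE|d y yE].
    - by rewrite !chi_N ?mulr0 //; case: Nid.
    - by rewrite cD dD yE zE mulrDr.
    - by rewrite -mulr_algl cM dM cC dC yE mulrCA.
  apply: neq; rewrite /u.
  have chE chi : is_character p chi -> chi (e (s0 - t0)) = chi (e s0) / chi (e t0).
    move=> ch; have [_ chM _ _] := ch.
    by apply: (canRL (mulfK (chi_unit _ _ ch))); rewrite -chM -eD subrK.
  rewrite !chE // (sub s0) // (sub t0) //.
  have h2 := chi_unit _ t0 ch2; have := chi_unit _ t0 ch1.
  by rewrite (sub t0) // mulf_eq0 negb_or => /andP[x0 _]; field; rewrite x0 h2.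
have [d dP] := rP (e s) (ex_intro2 _ _ s Ss erefl).
have [d' d'P] := r'P (e (- s)) (ex_intro2 _ _ s Ss erefl).
case/negP: sr.
apply: (@character_ratio _ p (e s) (e (- s)) chi1 chi2 a b c r r' w
   (fun i j => g (i, j)) ep d d') => //.
- exact: countable_closure_root.
- by move=> i j; apply: (gP (i, j)).
- move=> i j l; apply: ck; rewrite mem_cat; apply/orP; left.
  by apply/mapP; exists (i, j, l); rewrite ?mem_enum.
- by move=> l; apply: ck; rewrite !mem_cat codom_f !orbT.
- by move=> i; apply: ck; rewrite !mem_cat (codom_f (chi1 \o r)) !orbT.
- by move=> i; apply: ck; rewrite !mem_cat (codom_f (chi2 \o r)) !orbT.
- by move=> i; apply: ck; rewrite !mem_cat (codom_f (chi1 \o r')) !orbT.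
Qed.

End UncountableUnits.

(** * Regular functions and additive group actions *)

Section PolynomialClosure.
Variable k : fieldType.

Section Closure.
Variables (A : Type) (C : (A -> k) -> Prop).
Hypothesis Ccst : forall c, C (fun=> c).
Hypothesis CD : forall u v, C u -> C v -> C (fun a => u a + v a).
Hypothesis CM : forall u v, C u -> C v -> C (fun a => u a * v a).

Lemma closure_sum I (r : seq I) (P : pred I) (u : I -> A -> k) :
  (forall i, P i -> C (u i)) -> C (fun a => \sum_(i <- r | P i) u i a).
Proof.
move=> Cu; elim: r => [|i r IH].
  by under eq_fun do rewrite big_nil; apply: Ccst.
under eq_fun do rewrite big_cons; case Pi: (P i) => //.
by apply: CD => //; apply: Cu.
Qed.

Lemma closure_exp u n : C u -> C (fun a => u a ^+ n).
Proof.
move=> Cu; elim: n => [|n IH]; first exact: Ccst.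
by under eq_fun do rewrite exprS; apply: CM.
Qed.

(** The class [C] is abstract, so that the lemma serves polynomial functions of t, regular
    functions, [expandable] functions and the pairs of [twisted]. *)
Lemma closure_meval n (P : {mpoly k[n]}) (u : 'I_n -> A -> k) :
  (forall i, C (u i)) -> C (fun a => P.@[u^~ a]).
Proof.
move=> Cu; under eq_fun do rewrite mevalE.
apply: closure_sum => m _; apply: CM => //.
rewrite -/(index_enum _); elim: (index_enum _) => [|i r IH].
  by under eq_fun do rewrite big_nil; apply: Ccst.
by under eq_fun do rewrite big_cons; apply: CM => //; apply: closure_exp.
Qed.

Lemma closure_horner (p : {poly k}) u : C u -> C (fun a => p.[u a]).
Proof.
move=> Cu; under eq_fun do rewrite horner_coef.
by apply: closure_sum => i _; apply: CM => //; apply: closure_exp.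
Qed.

End Closure.

Definition polyfun (u : k -> k) : Prop := exists p : {poly k}, u = horner p.

Lemma polyfun_cst c : polyfun (fun=> c).
Proof. by exists c%:P; apply/funext => t; rewrite hornerC. Qed.

Lemma polyfun_id : polyfun id.
Proof. by exists 'X; apply/funext => t; rewrite hornerX. Qed.

Lemma polyfunD u v : polyfun u -> polyfun v -> polyfun (fun t => u t + v t).
Proof. by move=> [p ->] [q ->]; exists (p + q); apply/funext => t; rewrite hornerD. Qed.

Lemma polyfunM u v : polyfun u -> polyfun v -> polyfun (fun t => u t * v t).
Proof. by move=> [p ->] [q ->]; exists (p * q); apply/funext => t; rewrite hornerM. Qed.

Lemma polyfun_sum I (r : seq I) (P : pred I) (u : I -> k -> k) :
  (forall i, P i -> polyfun (u i)) -> polyfun (fun t => \sum_(i <- r | P i) u i t).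
Proof. exact: closure_sum polyfun_cst polyfunD _ _ _ _. Qed.

Lemma polyfun_comp u v : polyfun u -> polyfun v -> polyfun (fun t => u (v t)).
Proof.
move=> [p ->] v_poly.
exact: (closure_horner polyfun_cst polyfunD polyfunM).
Qed.

Lemma polyfun_meval n (P : {mpoly k[n]}) (u : 'I_n -> k -> k) :
  (forall i, polyfun (u i)) -> polyfun (fun t => P.@[u^~ t]).
Proof. exact: (closure_meval polyfun_cst polyfunD polyfunM). Qed.

Hypothesis k_char0 : [pchar k] =i pred0.

Lemma natr_inj : injective (fun n : nat => n%:R : k).
Proof.
move=> i j /eqP; wlog ij : i j / (i <= j)%N.
  move=> W; case: (leqP i j) => [/W|/ltnW/W h']; first exact.
  by rewrite eq_sym => /h' ->.
rewrite eq_sym -subr_eq0 -natrB // (pcharf0P k).1 // subn_eq0 => ji.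
by apply/eqP; rewrite eqn_leq ij.
Qed.

Lemma poly_eq_nat (p q : {poly k}) :
  (forall n, p.[n%:R] = q.[n%:R]) -> p = q.
Proof.
move=> pq; apply/eqP; rewrite -subr_eq0; apply/negP => /negP d0.
pose s := [seq (i%:R : k) | i <- iota 0 (size (p - q))].
have := @max_poly_roots _ (p - q) s d0.
rewrite size_map size_iota ltnn => h; apply: notF; apply: h.
  by apply/allP => _ /mapP[i _ ->]; rewrite rootE !hornerE pq subrr.
by rewrite map_inj_uniq ?iota_uniq //; apply: natr_inj.
Qed.

Lemma polyfun_eq (u v : k -> k) : polyfun u -> polyfun v ->
  (forall n, u n%:R = v n%:R) -> u =1 v.
Proof. by move=> [p ->] [q ->] /poly_eq_nat ->. Qed.

End PolynomialClosure.

(** * Regular functions on affine varieties *)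

Section RegularFunctions.
Variable k : closedFieldType.
Implicit Types X Y : affine_variety k.

Definition coord X (x : X) : 'I_(ambient_dim X) -> k := (\val x) ord0.

Lemma coord_inj X (x y : X) : coord x =1 coord y -> x = y.
Proof. by move=> xy; apply/val_inj/rowP => i; apply: xy. Qed.

Definition regfun X (f : X -> k) : Prop :=
  exists P : {mpoly k[ambient_dim X]}, f = fun x => P.@[coord x].

Lemma regfun_cst X c : @regfun X (fun=> c).
Proof. by exists c%:MP; apply/funext => x; rewrite mevalC. Qed.

Lemma regfun_coord X i : @regfun X (fun x => coord x i).
Proof. by exists 'X_i; apply/funext => x; rewrite mevalXU. Qed.

Lemma regfunD X (f g : X -> k) :
  regfun f -> regfun g -> regfun (fun x => f x + g x).
Proof. by move=> [P ->] [Q ->]; exists (P + Q); apply/funext => x; rewrite mevalD. Qed.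

Lemma regfunM X (f g : X -> k) :
  regfun f -> regfun g -> regfun (fun x => f x * g x).
Proof. by move=> [P ->] [Q ->]; exists (P * Q); apply/funext => x; rewrite mevalM. Qed.

Lemma regfunZ X c (f : X -> k) : regfun f -> regfun (fun x => c * f x).
Proof. by move=> rf; apply: regfunM => //; apply: regfun_cst. Qed.

Lemma regfunN X (f : X -> k) : regfun f -> regfun (fun x => - f x).
Proof. by move=> /(regfunZ (-1)); under eq_fun do rewrite mulN1r. Qed.

Lemma regfunB X (f g : X -> k) :
  regfun f -> regfun g -> regfun (fun x => f x - g x).
Proof. by move=> rf rg; apply: regfunD => //; apply: regfunN. Qed.

Lemma regfun_exp X (f : X -> k) n : regfun f -> regfun (fun x => f x ^+ n).
Proof. exact: (closure_exp (@regfun_cst X) (@regfunM X)). Qed.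

Lemma regfun_horner X (p : {poly k}) (f : X -> k) :
  regfun f -> regfun (fun x => p.[f x]).
Proof. exact: (closure_horner (@regfun_cst X) (@regfunD X) (@regfunM X)). Qed.

Lemma regfun_sum X I (r : seq I) (P : pred I) (u : I -> X -> k) :
  (forall i, P i -> regfun (u i)) -> regfun (fun t => \sum_(i <- r | P i) u i t).
Proof. exact: (closure_sum (@regfun_cst X) (@regfunD X)). Qed.

Lemma regularP X Y (f : X -> Y) :
  regular f <-> forall i, regfun (fun x => coord (f x) i).
Proof.
split=> [[P fP] i|/choice[P fP]].
  by exists (P i); apply/funext => x; rewrite /coord fP mxE.
exists P => x; apply/rowP => i; rewrite mxE.
by have := congr1 (@^~ x) (fP i); rewrite /coord.
Qed.

Lemma regular_coord X Y (f : X -> Y) i :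
  regular f -> regfun (fun x => coord (f x) i).
Proof. by move=> /regularP. Qed.

Lemma regfun_comp X Y (f : X -> Y) (h : Y -> k) :
  regular f -> regfun h -> regfun (fun x => h (f x)).
Proof.
move=> /regularP rf [P ->].
exact: (closure_meval (@regfun_cst X) (@regfunD X) (@regfunM X)) rf.
Qed.

Lemma regular_fst X Y : regular (@prod_fst k X Y).
Proof.
apply/regularP => i; exists 'X_(lshift _ i); apply/funext => z.
by rewrite mevalXU /coord mxE.
Qed.

Lemma regular_snd X Y : regular (@prod_snd k X Y).
Proof.
apply/regularP => i; exists 'X_(rshift _ i); apply/funext => z.
by rewrite mevalXU /coord mxE.
Qed.

Lemma regfun_mul_eq0 X (f g : X -> k) : irreducible_variety X ->
  regfun f -> regfun g -> (forall x, f x * g x = 0) ->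
  (forall x, f x = 0) \/ (forall x, g x = 0).
Proof.
move=> [_ Xirr] [P ->] [Q ->] PQ.
have cl (R : {mpoly k[ambient_dim X]}) : zariski_closed (zero_locus [set R]).
  by exists [set R].
have [|h|h] := Xirr _ _ (cl P) (cl Q).
- move=> x Xx; have xX : x \in (X : set _) by apply: mem_set.
  have /eqP := PQ (exist _ x xX); rewrite mulf_eq0 => /orP[] /eqP h.
    by left=> R ->.
  by right=> R ->.
- by left=> x; apply: (h (\val x) (set_mem (valP x)) P erefl).
- by right=> x; apply: (h (\val x) (set_mem (valP x)) Q erefl).
Qed.

Lemma regfun_dense X (h f g : X -> k) : irreducible_variety X ->
  regfun h -> regfun f -> regfun g -> (exists x, h x != 0) ->
  (forall x, h x != 0 -> f x = g x) -> f =1 g.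
Proof.
move=> Xirr rh rf rg [x0 hx0] fg.
have [|h0|h0 x] := regfun_mul_eq0 Xirr rh (regfunB rf rg).
- move=> x; have [->|/fg ->] := eqVneq (h x) 0; first by rewrite mul0r.
  by rewrite subrr mulr0.
- by rewrite h0 eqxx in hx0.
- by apply/eqP; rewrite -subr_eq0 h0.
Qed.

Lemma iter_regular X (f : X -> X) n : regular f -> regular (iter n f).
Proof.
by move=> rf; elim: n => [|n IH]; [apply: regular_id|apply: regular_comp].
Qed.

End RegularFunctions.

(** * Unipotence from iterates polynomial in n *)

Section UnipotentCriterion.
Variable k : closedFieldType.
Hypothesis k_char0 : [pchar k] =i pred0.

(** Replacing n by t in the formula for the iterates defines the action. The equations of [X] and
    the law of an action are polynomial identities in the parameters that hold at all natural
    numbers, an infinite set in characteristic 0. *)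
Lemma unipotent_interpolation (X : affine_variety k) (g : automorphism X) d
    (Q : 'I_d -> {poly k}) (c : 'I_d -> X -> 'I_(ambient_dim X) -> k) :
  (forall l i, regfun (fun x => c l x i)) ->
  (forall n x i, coord (iter n g x) i = \sum_l (Q l).[n%:R] * c l x i) ->
  unipotent g.
Proof.
move=> c_reg g_iter.
pose b0 t x : 'rV[k]_(ambient_dim X) := \row_i \sum_l (Q l).[t] * c l x i.
have b0_poly x i : polyfun (fun t => b0 t x ord0 i).
  under eq_fun do rewrite mxE; apply: polyfun_sum => l _.
  apply: polyfunM; last exact: polyfun_cst.
  by exists (Q l).
have b0n n x : b0 n%:R x = \val (iter n g x).
  by apply/rowP => i; rewrite mxE -g_iter.
have b0X t x : b0 t x \in (X : set _).
  apply: mem_set; have [S XS] := points_closed X; rewrite XS => P SP.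
  have := @polyfun_eq _ k_char0 (fun t => P.@[b0 t x ord0]) (fun=> 0).
  apply; [|exact: polyfun_cst|].
    exact: (polyfun_meval P (b0_poly x)).
  move=> n; rewrite b0n.
  have := set_mem (valP (iter n g x)); rewrite {1}XS; exact.
pose b t x : X := exist _ (b0 t x) (b0X t x).
have b_poly x i : polyfun (fun t => coord (b t x) i) by exact: b0_poly.
have bn n x : b n%:R x = iter n g x by apply: val_inj; rewrite /= b0n.
have b_reg : @regular _ (prod_variety (affine_space k 1) X) X
    (fun z => b (\val (prod_fst z) ord0 ord0) (prod_snd z)).
  apply/regularP => i; under eq_fun do rewrite /coord /= mxE.
  apply: regfun_sum => l _; apply: regfunM.
    apply: regfun_horner.
    pose i0 : 'I_(ambient_dim (affine_space k 1)) := (ord0 : 'I_1).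
    exact: (regfun_comp (@regular_fst _ (affine_space k 1) X) (regfun_coord i0)).
  exact: (regfun_comp (regular_snd _ _) (c_reg l i)).
have bD s t x : b (s + t) x = b s (b t x).
  have coord_poly i (u : k -> X) : (forall j, polyfun (fun t => coord (u t) j)) ->
      forall s, polyfun (fun t => coord (b s (u t)) i).
    move=> u_poly r; under eq_fun do rewrite /coord /= mxE.
    apply: polyfun_sum => l _; apply: polyfunM; first exact: polyfun_cst.
    have [P cE] := c_reg l i.
    have -> : (fun t => c l (u t) i) = fun t => P.@[coord (u t)].
      by apply/funext => t'; exact: (congr1 (@^~ (u t')) cE).
    exact: polyfun_meval.
  have shift_poly i r : polyfun (fun t => coord (b (r + t) x) i).
    apply: (polyfun_comp (b_poly x i)).
    by apply: polyfunD; [apply: polyfun_cst|apply: polyfun_id].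
  apply: coord_inj => i.
  apply: (polyfun_eq k_char0 (shift_poly i s) (coord_poly i _ (b_poly x) s)) => n.
  rewrite bn addrC; pose y := iter n g x.
  apply: (polyfun_eq k_char0 (shift_poly i n%:R) (b_poly y i)) => m.
  by rewrite -natrD !bn -iterD addnC.
have b0x x : b 0 x = x by rewrite -[0]/(0%:R) bn.
exists (GaAction b_reg b0x bD), 1 => //.
by apply: automorphism_ext => x /=; rewrite -[1]/(1%:R) (bn 1%N).
Qed.

End UnipotentCriterion.

Lemma poly_shift_top (k : fieldType) (k_char0 : [pchar k] =i pred0)
    (p q : {poly k}) (c : k) n :
  (size p <= n.+2)%N -> (forall t, q.[t] = p.[c + t]) ->
  q`_n.+1 = p`_n.+1 /\ q`_n = p`_n + c * (n.+1%:R * p`_n.+1).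
Proof.
move=> sp qp.
have -> : q = \poly_(i < n.+2) p^`N(i).[c].
  apply: (poly_eq_nat k_char0) => m; rewrite qp horner_poly.
  rewrite nderiv_taylor; last exact: mulrC.
  rewrite (big_ord_widen n.+2 (fun i => p^`N(i).[c] * m%:R ^+ i)) //.
  rewrite big_mkcond /=; apply: eq_bigr => i _; case: ltnP => // le.
  rewrite (_ : p^`N(i) = 0) ?horner0 ?mul0r //.
  apply/polyP => j; rewrite coef_nderivn coef0 nth_default ?mul0rn //.
  by rewrite (leq_trans le) // leq_addr.
have coefN i m : (n.+2 <= i + m)%N -> (size p^`N(i) <= m)%N.
  move=> le; apply/leq_sizeP => j mj.
  rewrite coef_nderivn nth_default ?mul0rn //.
  by apply: leq_trans sp (leq_trans le _); rewrite leq_add2l.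
rewrite !coef_poly ltnSn ltnS leqnSn; split.
  rewrite (@horner_coef_wide _ 1) ?coefN ?addn1 //.
  by rewrite big_ord1 coef_nderivn addn0 binn mulr1n mulr1.
rewrite (@horner_coef_wide _ 2) ?coefN ?addn2 //.
rewrite big_ord_recl big_ord1 /= !coef_nderivn addn0 binn mulr1n expr0 mulr1.
by rewrite (_ : bump 0 0 = 1%N) // addn1 binSn expr1 mulr_natl mulrC.
Qed.

(** * Additive group actions, local slices and double centralizers *)

Section GaActions.
Variables (k : closedFieldType) (X : affine_variety k).
Hypothesis k_char0 : [pchar k] =i pred0.
Variable a : Ga_action X.

Definition expandable (u : k * X -> k) : Prop :=
  exists (p : X -> {poly k}) d, [/\ forall x, (size (p x) <= d)%N,
    forall j, regfun (fun x => (p x)`_j) & forall t x, u (t, x) = (p x).[t]].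

Lemma expandable_regfun f : regfun f -> expandable (fun w => f w.2).
Proof.
move=> rf; exists (fun x => (f x)%:P), 1%N; split=> [x|j|t x] /=.
- exact: size_polyC_leq1.
- by under eq_fun do rewrite coefC; case: eqP => // _; apply: regfun_cst.
- by rewrite hornerC.
Qed.

Lemma expandable_fst : expandable fst.
Proof.
exists (fun=> 'X), 2%N; split=> [x|j|t x] /=; first by rewrite size_polyX.
  exact: regfun_cst.
by rewrite hornerX.
Qed.

Lemma expandableD u v : expandable u -> expandable v ->
  expandable (fun w => u w + v w).
Proof.
move=> [p [d [pd pr pu]]] [q [e [qe qr qv]]].
exists (fun x => p x + q x), (maxn d e); split=> [x|j|t x].
- apply: leq_trans (size_polyD _ _) _.
  by rewrite geq_max !leq_max pd qe orbT.
- by under eq_fun do rewrite coefD; apply: regfunD.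
- by rewrite hornerD pu qv.
Qed.

Lemma expandableM u v : expandable u -> expandable v ->
  expandable (fun w => u w * v w).
Proof.
move=> [p [d [pd pr pu]]] [q [e [qe qr qv]]].
exists (fun x => p x * q x), (d + e)%N; split=> [x|j|t x].
- apply: leq_trans (size_polyMleq _ _) _.
  by apply: leq_trans (leq_pred _) _; apply: leq_add.
- under eq_fun do rewrite coefM.
  by apply: regfun_sum => i _; apply: regfunM.
- by rewrite hornerM pu qv.
Qed.

Lemma Ga_expandable f : regfun f -> expandable (fun w => f (a w.1 w.2)).
Proof.
have cst c : expandable (fun=> c) by apply: expandable_regfun; apply: regfun_cst.
have meval_exp := closure_meval cst expandableD expandableM.
suff coord_exp i : expandable (fun w => coord (a w.1 w.2) i).
  by move=> [P ->]; apply: meval_exp.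
have [P aP] := Ga_act_regular a.
pose z (w : k * X) : prod_variety (affine_space k 1) X :=
  exist _ (row_mx w.1%:M (\val w.2)) (mem_set (conj
    (I : setT (lsubmx (row_mx w.1%:M (\val w.2))))
    (eq_ind_r (X : set _) (set_mem (valP w.2)) (row_mxKr w.1%:M (\val w.2))))).
have zx w : prod_snd (z w) = w.2 by apply: val_inj; rewrite /= row_mxKr.
have zt w : \val (prod_fst (z w)) ord0 ord0 = w.1.
  by rewrite /= row_mxKl mxE eqxx.
have -> : (fun w => coord (a w.1 w.2) i) = fun w => (P i).@[coord (z w)].
  by apply/funext => w; rewrite /coord -(zt w) -{1}(zx w) aP mxE.
apply: meval_exp => j.
have -> : (fun w => coord (z w) j) = fun w =>
    match @fintype.split 1 (ambient_dim X) j with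
    | inl _ => w.1
    | inr l => coord w.2 l
    end.
  apply/funext => w; rewrite /coord mxE; case: fintype.split => l //.
  by rewrite (ord1 l) mxE eqxx.
case: fintype.split => l; first exact: expandable_fst.
exact: (expandable_regfun (regfun_coord l)).
Qed.

Lemma Ga_polyfun f x : regfun f -> polyfun (fun t => f (a t x)).
Proof.
move=> /Ga_expandable[p [d [_ _ pE]]]; exists (p x).
by apply/funext => t; rewrite -pE.
Qed.

Lemma Ga_act_mulrn s n x : a (s *+ n) x = iter n (a s) x.
Proof.
by elim: n => [|n IH]; rewrite ?mulr0n ?Ga_act0 // mulrS Ga_actD IH.
Qed.

Lemma Ga_polyfun_eq (f g : k -> X) s : s != 0 ->
  (forall i, polyfun (fun t => coord (f t) i)) ->
  (forall i, polyfun (fun t => coord (g t) i)) ->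
  (forall n, f (s *+ n) = g (s *+ n)) -> f =1 g.
Proof.
move=> s0 f_poly g_poly fg t; apply: coord_inj => i.
have lin : polyfun ( *%R s) by exists (s *: 'X); apply/funext => u; rewrite !hornerE.
have := polyfun_eq k_char0 (polyfun_comp (f_poly i) lin) (polyfun_comp (g_poly i) lin).
move=> /(_ _ (t / s)); rewrite mulrCA divff // mulr1; apply=> n.
by rewrite mulr_natr fg.
Qed.

(** Both sides are polynomial in t and agree at the multiples of [s]. *)
Lemma Ga_commute (tau : automorphism X) s : s != 0 ->
  (tau * Ga_aut a s = Ga_aut a s * tau)%g -> forall t x, tau (a t x) = a t (tau x).
Proof.
move=> s0 comm t x; move: t; apply: (Ga_polyfun_eq s0) => [i|i|n].
- apply: (@Ga_polyfun (fun y => coord (tau y) i)).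
  exact: regular_coord (aut_regular tau).
- exact: (Ga_polyfun _ (regfun_coord i)).
- rewrite !Ga_act_mulrn; elim: n => //= n <-.
  by have /(congr1 (fun f : automorphism X => f (iter n (a s) x))) := comm.
Qed.

Lemma Ga_trivial s : s != 0 -> (forall x, a s x = x) -> forall t x, a t x = x.
Proof.
move=> s0 triv t x; move: t; apply: (Ga_polyfun_eq s0) => [i|i|n].
- exact: (Ga_polyfun _ (regfun_coord i)).
- exact: polyfun_cst.
- by rewrite Ga_act_mulrn; elim: n => //= n ->.
Qed.

Definition invariant q := forall t (x : X), q (a t x) = q x :> k.

Lemma invariant_replica q : regfun q -> invariant q ->
  exists R : automorphism X, forall x, R x = a (q x) x.
Proof.
have reg q' : regfun q' -> regular (fun x => a (q' x) x).
  move=> rq; apply/regularP => i.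
  have [p [d [pd pr pE]]] := Ga_expandable (regfun_coord i).
  have -> : (fun x => coord (a (q' x) x) i) =
      fun x => \sum_(j < d) (p x)`_j * q' x ^+ j.
    by apply/funext => x; rewrite (pE _ x) (horner_coef_wide _ (pd x)).
  by apply: regfun_sum => j _; apply: regfunM => //; apply: regfun_exp.
move=> rq qinv.
have K1 : cancel (fun x => a (q x) x) (fun x => a (- q x) x).
  by move=> x /=; rewrite qinv -Ga_actD addNr Ga_act0.
have K2 : cancel (fun x => a (- q x) x) (fun x => a (q x) x).
  by move=> x /=; rewrite qinv -Ga_actD subrr Ga_act0.
by exists (Automorphism (reg _ rq) (reg _ (regfunN rq)) K1 K2).
Qed.

(** Expand a non-invariant coordinate along orbits as a polynomial in t, of degree n + 1 at a
    generic point. By [poly_shift_top] its top coefficient is invariant, and the next one moves by t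
    times a multiple of the top one. *)
Lemma local_slice : (exists t x, a t x <> x) ->
  exists s h : X -> k, [/\ regfun s, regfun h, invariant h, exists x, h x != 0 &
    forall t x, s (a t x) = s x + t * h x].
Proof.
move=> [t0 [x0 tx0]].
have [i ti0] : exists i, coord (a t0 x0) i <> coord x0 i.
  by apply: contrapT => /forallNP h; apply: tx0; apply: coord_inj => i;
    apply: contrapT; apply: h.
have [p [d [pd pr pE]]] := Ga_expandable (regfun_coord i).
have exP : exists m, `[< exists x, size (p x) = m >].
  by exists (size (p x0)); apply/asboolP; exists x0.
have leP m : `[< exists x, size (p x) = m >] -> (m <= d)%N.
  by move=> /asboolP[x <-].
have [D /asboolP[x1 Dx1] Dmax] := ex_maxnP exP leP.
have {}Dmax x : (size (p x) <= D)%N by apply: Dmax; apply/asboolP; exists x.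
have : (1 < D)%N.
  rewrite ltnNge; apply/negP => D1; apply: ti0.
  move: (pE t0 x0) (pE 0 x0) => /=.
  rewrite Ga_act0 => -> -> /=.
  by rewrite (size1_polyC (leq_trans (Dmax x0) D1)) !hornerC.
case: D => [|[|n]] // in Dx1 Dmax * => _.
have shift t x := @poly_shift_top _ k_char0 (p x) (p (a t x)) t n (Dmax x).
have pshift t x u : (p (a t x)).[u] = (p x).[t + u].
  by rewrite -(pE u) -(pE (t + u)) /= addrC Ga_actD.
exists (fun x => (p x)`_n), (fun x => n.+1%:R * (p x)`_n.+1); split=> //.
- exact: regfunZ.
- by move=> t x; have [-> _] := shift t x (pshift t x).
- exists x1; rewrite mulf_neq0 //; first by rewrite (pcharf0P k).1.
  by rewrite -[n.+1]/(n.+2.-1) -Dx1 -lead_coefE lead_coef_eq0 -size_poly_gt0 Dx1.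
- by move=> t x; have [_ ->] := shift t x (pshift t x).
Qed.

(** Where [h] does not vanish, [tau] moves x along its orbit by the time c / h, which is invariant;
    so the n-th iterate moves it by n c / h and is polynomial in n. *)
Lemma bicentralizer_unipotent (r : k) (tau : automorphism X) :
  irreducible_variety X -> r != 0 -> (exists t x, a t x <> x) ->
  (forall sg : automorphism X, (sg * Ga_aut a r = Ga_aut a r * sg)%g ->
     (sg * tau = tau * sg)%g) ->
  unipotent tau.
Proof.
move=> Xirr r0 nontriv bicent.
have [s [h [rs rh hinv [x1 hx1] sE]]] := local_slice nontriv.
have comm t x : tau (a t x) = a t (tau x).
  by apply: (Ga_commute r0); apply/esym/bicent.
have reg_tau f : regfun f -> regfun (fun x => f (tau x)).
  by apply: regfun_comp; apply: aut_regular.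
have hne_tau : exists x, h (tau x) != 0.
  by exists (aut_inv tau x1); rewrite aut_invK.
have hne : exists x, h x != 0 by exists x1.
(* The replica x |-> a(q x) x commutes with a(r), hence with [tau]. Comparing the values of the
   slice [s] gives the equality where h (tau x) is nonzero. *)
have fixed q : regfun q -> invariant q -> forall x, q (tau x) = q x.
  move=> rq qinv; have [R RE] := invariant_replica rq qinv.
  have commR x : R (tau x) = tau (R x).
    have Ra : (R * Ga_aut a r = Ga_aut a r * R)%g.
      by apply: automorphism_ext => y /=; rewrite !RE qinv -!Ga_actD addrC.
    by have := congr1 (fun f : automorphism X => f x) (bicent R Ra).
  apply: (regfun_dense Xirr (reg_tau _ rh) (reg_tau _ rq) rq hne_tau) => x hx.
  have := commR x; rewrite !RE comm => /(congr1 s); rewrite !sE.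
  by move=> /addrI /(mulIf hx).
pose c x := s (tau x) - s x.
have rc : regfun c by apply: regfunB => //; apply: reg_tau.
have cinv : invariant c.
  move=> t x; rewrite /c comm !sE (fixed h) //; ring.
have reg_a t f : regfun f -> regfun (fun x => f (a t x)).
  by apply: regfun_comp; apply: Ga_aut_regular.
have tauE x : h x != 0 -> tau x = a (c x / h x) x.
  move=> hx.
  (* The point a(- s x / h x) x is where the orbit of x meets s = 0. Its coordinates are invariant,
     and multiplying them by h^d gives regular invariants [F], which [tau] fixes. *)
  have eqs : a (- s (tau x) / h x) (tau x) = a (- s x / h x) x.
    apply: coord_inj => i.
    have [p [d [pd pr pE]]] := Ga_expandable (regfun_coord i).
    pose F y := \sum_(j < d) (p y)`_j * ((- s y) ^+ j * h y ^+ (d - j)).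
    have FE y : h y != 0 -> F y = h y ^+ d * coord (a (- s y / h y) y) i.
      move=> hy; rewrite (pE _ y) (horner_coef_wide _ (pd y)) mulr_sumr.
      apply: eq_bigr => j _; have -> : h y ^+ d = h y ^+ (d - j) * h y ^+ j.
        by rewrite -exprD subnK // ltnW.
      by rewrite expr_div_n; field; rewrite expf_neq0.
    have rF : regfun F.
      apply: regfun_sum => j _; apply: regfunM => //; apply: regfunM.
        by apply: regfun_exp; apply: regfunN.
      exact: regfun_exp.
    have Finv : invariant F.
      move=> t; apply: (regfun_dense Xirr rh (reg_a t _ rF) rF hne) => y hy.
      rewrite !FE ?hinv // -Ga_actD sE; congr (_ * coord (a _ _) _).
      by field.
    have := fixed F rF Finv x; rewrite !FE ?(fixed h) //.
    by apply: mulfI; rewrite expf_neq0.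
  have := congr1 (a (s (tau x) / h x)) eqs.
  rewrite -!Ga_actD mulNr subrr Ga_act0 => ->; congr (a _ _).
  by rewrite /c mulrBl mulNr.
have iterE n x : h x != 0 -> iter n tau x = a (n%:R * (c x / h x)) x.
  move=> hx; elim: n => [|n IH]; first by rewrite mul0r Ga_act0.
  rewrite iterS IH comm tauE // -Ga_actD; congr (a _ _).
  by rewrite -natr1; ring.
have /choice[p /choice[d pdP]] i := Ga_expandable (regfun_coord (X := X) i).
pose D := (\max_i d i).+1.
(* Lagrange interpolation at 0, ..., D - 1 expresses every iterate through the first D ones. These
   are regular everywhere, so the denominators h disappear and density extends the formula to all of
   [X]. *)
apply: (@unipotent_interpolation _ k_char0 X tau D
  (fun l => tnth (qpoly.lagrange D (fun n => n%:R)) l)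
  (fun l x i => coord (iter l tau x) i)).
- by move=> l i; exact: regular_coord (iter_regular _ (aut_regular tau)).
- move=> n x i; move: x.
  have riter m : regfun (fun x => coord (iter m tau x) i).
    exact: regular_coord (iter_regular _ (aut_regular tau)).
  apply: (regfun_dense Xirr rh _ _ hne) => //.
    by apply: regfun_sum => l _; apply: regfunZ.
  move=> x hx; have [pd _ pE] := pdP i.
  pose P := (p i x) \Po ((c x / h x) *: 'X).
  have PE m : P.[m%:R] = coord (iter m tau x) i.
    rewrite iterE // (pE _ x) /P horner_comp; congr (_.[_]).
    by rewrite hornerZ hornerX mulrC.
  have sP : (size P <= D)%N.
    apply: leq_trans (size_comp_poly_leq _ _) _; rewrite ltnS.
    apply: leq_trans (_ : (size (p i x)).-1 * 1 <= _)%N.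
      rewrite leq_mul2l; apply/orP; right.
      have := size_scale_leq (c x / h x) 'X; rewrite size_polyX.
      by case: size => [|[|[]]].
    rewrite muln1; apply: leq_trans (leq_pred _) _.
    by apply: leq_trans (pd x) _; apply: leq_bigmax.
  have := qpoly.lagrange_gen (ltn0Sn _) (natr_inj k_char0) sP.
  move=> /(congr1 (horner^~ n%:R)); rewrite PE => ->.
  rewrite horner_sum; apply: eq_bigr => l _.
  by rewrite hornerM hornerC PE mulrC.
Qed.

End GaActions.

(** * Algebraic automorphisms *)

Section TorsionCharacters.
Variable k : closedFieldType.

Definition torsion (x : k) : Prop := exists2 n, (0 < n)%N & x ^+ n = 1.

Record torsion_character (G : set k) (chi : k -> k) : Prop := TorsionCharacter {
  tchar_neq0 : forall x, G x -> x != 0;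
  tchar1 : G 1;
  tcharM : forall x y, G x -> G y -> G (x * y);
  tcharV : forall x, G x -> G x^-1;
  tchar_morph : forall x y, G x -> G y -> chi (x * y) = chi x * chi y;
  tchar_torsion : forall x, G x -> torsion (chi x) }.

Lemma torsion_neq0 x : torsion x -> x != 0.
Proof.
move=> [n n0 xn]; apply/eqP => x0.
by move/eqP: xn; rewrite x0 expr0n -leqn0 leqNgt n0 eq_sym oner_eq0.
Qed.

Lemma torsionM x y : torsion x -> torsion y -> torsion (x * y).
Proof.
move=> [n n0 xn] [m m0 ym]; exists (n * m)%N; first by rewrite muln_gt0 n0.
by rewrite exprMn exprM xn expr1n mul1r mulnC exprM ym expr1n.
Qed.

Lemma torsionX x (i : int) : torsion x -> torsion (x ^ i).
Proof.
move=> [n n0 xn]; exists n => //.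
by rewrite exprnP exprzAC -exprnP xn exp1rz.
Qed.

Section Extension.
Variables (G : set k) (chi : k -> k).
Hypothesis chiP : torsion_character G chi.

Lemma tchar_one : chi 1 = 1.
Proof.
have G1 := tchar1 chiP.
apply: (mulfI (torsion_neq0 (tchar_torsion chiP G1))).
by rewrite -(tchar_morph chiP) // !mulr1.
Qed.

Lemma tchar_exp x (i : int) : G x -> G (x ^ i) /\ chi (x ^ i) = chi x ^ i.
Proof.
move=> Gx.
have nat_case n : G (x ^+ n) /\ chi (x ^+ n) = chi x ^+ n.
  elim: n => [|n [IH1 IH2]].
    by rewrite !expr0 tchar_one; split=> //; apply: tchar1 chiP.
  by rewrite !exprS; split; rewrite ?(tchar_morph chiP) ?IH2 //; apply: (tcharM chiP).
case: i => n; first exact: nat_case.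
have [Gn chin] := nat_case n.+1; rewrite !NegzE -!exprnN.
split; first exact: (tcharV chiP).
apply: (mulfI (torsion_neq0 (tchar_torsion chiP Gn))).
rewrite -(tchar_morph chiP) //; last exact: (tcharV chiP).
by rewrite divff ?(tchar_neq0 chiP Gn) // chin divff ?tchar_one // -chin
  torsion_neq0 //; apply: (tchar_torsion chiP).
Qed.

(** Two expressions g la^i of the same element differ by a power of [la] lying in [G], where [w] is
    compatible with [chi]; so chi g * w^i is well defined. *)
Lemma tchar_extend (la w : k) : la != 0 -> torsion w ->
  (forall i : int, G (la ^ i) -> chi (la ^ i) = w ^ i) ->
  exists G' chi', [/\ torsion_character G' chi', G `<=` G', G' la,
    forall x, G x -> chi' x = chi x & chi' la = w].
Proof.
move=> la0 wt compat.
have w0 := torsion_neq0 wt.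
pose G' := [set x | exists g (i : int), G g /\ x = g * la ^ i].
have /choice[chi' chi'P] x : exists y, G' x ->
    exists g (i : int), [/\ G g, x = g * la ^ i & y = chi g * w ^ i].
  have [[g [i [Gg xE]]]|] := pselect (G' x); last by exists 0.
  by exists (chi g * w ^ i); exists g, i.
have chi'E g (i : int) : G g -> chi' (g * la ^ i) = chi g * w ^ i.
  move=> Gg; have [|h [j [Gh e ->]]] := chi'P (g * la ^ i); first by exists g, i.
  have g0 := tchar_neq0 chiP Gg; have h0 := tchar_neq0 chiP Gh.
  have hE : h = g * la ^ (i - j).
    by rewrite expfzDr // mulrA e -mulrA -expfzDr // subrr expr0z mulr1.
  have Gla : G (la ^ (i - j)).
    have -> : la ^ (i - j) = h * g^-1 by rewrite hE mulrC mulKf.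
    by apply: (tcharM chiP) => //; apply: (tcharV chiP).
  by rewrite hE (tchar_morph chiP) // compat // -mulrA -expfzDr // subrK.
have GG' : G `<=` G' by move=> g Gg; exists g, 0; rewrite expr0z mulr1.
have chi'G x : G x -> chi' x = chi x.
  by move=> Gx; have := chi'E x 0 Gx; rewrite !expr0z !mulr1.
exists G', chi'; split=> //.
- split.
  + move=> _ [g [i [Gg ->]]]; rewrite mulf_neq0 ?(tchar_neq0 chiP Gg) //.
    by rewrite expfz_neq0.
  + by apply: GG'; apply: tchar1 chiP.
  + move=> _ _ [g [i [Gg ->]]] [h [j [Gh ->]]]; exists (g * h), (i + j).
    by split; [apply: (tcharM chiP)|rewrite expfzDr // mulrACA].
  + move=> _ [g [i [Gg ->]]]; exists g^-1, (- i).
    by split; [apply: (tcharV chiP)|rewrite invfM invr_expz].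
  + move=> _ _ [g [i [Gg ->]]] [h [j [Gh ->]]].
    rewrite mulrACA -expfzDr // !chi'E //; last exact: (tcharM chiP).
    by rewrite (tchar_morph chiP) // expfzDr // mulrACA.
  + move=> _ [g [i [Gg ->]]]; rewrite chi'E //; apply: torsionM.
      exact: (tchar_torsion chiP).
    exact: torsionX.
- exists 1, 1; split; first exact: tchar1 chiP.
  by rewrite mul1r expr1z.
- by have := chi'E 1 1 (tchar1 chiP); rewrite mul1r !expr1z tchar_one mul1r.
Qed.

(** If la^(m+1) is the first positive power in [G], the exponents occurring are the multiples of m +
    1, and [w] is an (m+1)-th root of its image. If there is none, w = 1 will do. *)
Lemma tchar_value (la : k) : la != 0 -> exists2 w, torsion w &
  forall i : int, G (la ^ i) -> chi (la ^ i) = w ^ i.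
Proof.
move=> la0; have [[m0 Gm0]|ntors] := pselect (exists m, G (la ^+ m.+1)).
  have exm : exists m, `[< G (la ^+ m.+1) >] by exists m0; apply/asboolP.
  have [m /asboolP Gm mmin] := ex_minnP exm.
  have [w] : exists w, root ('X^(m.+1) - (chi (la ^+ m.+1))%:P) w.
    by apply: closed_rootP; rewrite size_XnsubC.
  rewrite rootE !hornerE subr_eq0 => /eqP wE; exists w.
    have [n n0 cn] := tchar_torsion chiP Gm.
    by exists (m.+1 * n)%N; rewrite ?muln_gt0 // exprM wE.
  move=> i Gi; have iE := divz_eq i m.+1; set q := (i %/ _)%Z in iE.
  have [Gq chiq] := tchar_exp q Gm.
  have laE : la ^ i = (la ^+ m.+1) ^ q * la ^ (i %% m.+1)%Z.
    by rewrite {1}iE expfzDr // exprnP exprz_exp [_%:Z * q]mulrC.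
  have Gr : G (la ^ (i %% m.+1)%Z).
    have -> : la ^ (i %% m.+1)%Z = ((la ^+ m.+1) ^ q)^-1 * la ^ i.
      by rewrite laE mulKf // expfz_neq0 // expf_neq0.
    by apply: (tcharM chiP) => //; apply: (tcharV chiP).
  have r0 : (i %% m.+1)%Z = 0.
    have := ltz_pmod i (isT : 0 < m.+1%:Z).
    have : (0 <= i %% m.+1)%Z by apply: modz_ge0.
    case: (i %% m.+1)%Z Gr => [[|r]|//] Gr _ // rm.
    have /mmin := asboolT Gr; rewrite leqNgt; case/negP.
    by move: rm; rewrite ltz_nat ltnS.
  by rewrite laE r0 expr0z mulr1 chiq -wE iE r0 addr0 mulrC exprnP exprz_exp.
exists 1; first by exists 1%N; rewrite ?expr1n.
have npos n : ~ G (la ^+ n.+1) by move=> h; apply: ntors; exists n.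
move=> [[|n]|n].
- by rewrite !expr0z tchar_one.
- by move=> /npos.
- by rewrite NegzE -exprnN => /(tcharV chiP); rewrite invrK => /npos.
Qed.

End Extension.

Lemma tchar_extend_seq (l : seq k) G chi : torsion_character G chi ->
  {in l, forall x, x != 0} ->
  exists G' chi', [/\ torsion_character G' chi', G `<=` G',
    {in l, forall x, G' x} & forall x, G x -> chi' x = chi x].
Proof.
elim: l G chi => [|la l IH] G chi chiP l0; first by exists G, chi; split=> // x; rewrite in_nil.
have la0 : la != 0 by apply: l0; rewrite mem_head.
have [w wt wP] := tchar_value chiP la0.
have [G1 [chi1 [chi1P GG1 G1la e1 _]]] := tchar_extend chiP la0 wt wP.
have [|G2 [chi2 [chi2P G12 G2l e2]]] := IH _ _ chi1P.
  by move=> x xl; apply: l0; rewrite inE xl orbT.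
exists G2, chi2; split=> //; first exact: subset_trans GG1 G12.
- by move=> x; rewrite inE => /orP[/eqP->|/G2l //]; apply: G12.
- by move=> x Gx; rewrite e2 ?e1 //; apply: GG1.
Qed.

Lemma torsion_character_exists (l : seq k) la : [pchar k] =i pred0 ->
  {in l, forall x, x != 0} -> la \in l -> la != 1 ->
  exists G chi, [/\ torsion_character G chi, {in l, forall x, G x} & chi la != 1].
Proof.
move=> k_char0 l0 lal la1.
have tors1 : torsion 1 by exists 1%N; rewrite ?expr1n.
have triv : torsion_character [set 1] (fun=> 1).
  split=> //= [x -> |x y -> -> |x ->|x y _ _]; rewrite ?oner_neq0 ?mulr1 ?invr1 //.
(* If [la] is a root of unity, it can be its own image; otherwise it is free over the trivial group
   and may be sent to -1. *)
have [w [wt w1 wP]] : exists w, [/\ torsion w, w != 1 &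
    forall i : int, [set (1 : k)] (la ^ i) -> 1 = w ^ i].
  have [lat|nt] := pselect (torsion la); first by exists la; split=> // i /= ->.
  exists (-1); split.
  - by exists 2%N; rewrite // sqrrN expr1n.
  - rewrite -subr_eq0 -opprD oppr_eq0 -[1 + 1]/(2%:R) (pcharf0P k).1 //.
  have npos n : la ^+ n.+1 <> 1 by move=> h; apply: nt; exists n.+1.
  move=> [[|n]|n] //=; first by move=> /npos.
  by rewrite NegzE -exprnN => /eqP; rewrite invr_eq1 => /eqP/npos.
have [G1 [chi1 [chi1P G1sub G1la _ chila]]] := tchar_extend triv (l0 _ lal) wt wP.
have [G2 [chi2 [chi2P G12 G2l e2]]] := tchar_extend_seq chi1P l0.
by exists G2, chi2; split=> //; rewrite e2 // chila.
Qed.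

End TorsionCharacters.

(** * Chinese remainders for powers of linear factors *)

Section CoprimePowers.
Variable k : fieldType.
Implicit Types (rs : seq k) (e : nat).

Lemma coprimep_XsubC_prod la rs e : la \notin rs ->
  coprimep (('X - la%:P) ^+ e) (\prod_(mu <- rs) ('X - mu%:P) ^+ e).
Proof.
move=> lars; apply: coprimep_expl; rewrite coprimep_sym coprimep_XsubC.
rewrite rootE horner_prod prodf_seq_neq0; apply/allP => mu mur.
rewrite implyTb horner_exp hornerXsubC expf_neq0 // subr_eq0.
by apply: contraNneq lars => ->.
Qed.

Lemma chinese_XsubC rs e (v : k -> k) : uniq rs ->
  exists Q : {poly k}, {in rs, forall la, ('X - la%:P) ^+ e %| Q - (v la)%:P}.
Proof.
elim: rs => [|la rs IH] /=; first by exists 0.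
move=> /andP[lars /IH[Q QP]].
have /Bezout_eq1_coprimepP[[a b] /= ab] := coprimep_XsubC_prod e lars.
set p := ('X - la%:P) ^+ e in ab; set P := \prod_(mu <- _) _ in ab.
(* b P is 1 modulo [p] and 0 modulo the other powers, so the correction acts at [la] only. *)
exists (Q + b * P * ((v la)%:P - Q)) => mu; rewrite inE => /orP[/eqP->|mur].
  have -> : Q + b * P * ((v la)%:P - Q) - (v la)%:P = p * (a * (Q - (v la)%:P)).
    have -> : b * P = 1 - a * p by rewrite -ab addrC addKr.
    by ring.
  exact: dvdp_mulr.
rewrite addrAC dvdp_add ?QP // mulrAC dvdp_mull // /P (big_rem mu) //=.
exact: dvdp_mulr.
Qed.

Lemma dvdp_prod_XsubC rs e (p : {poly k}) : uniq rs ->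
  {in rs, forall la, ('X - la%:P) ^+ e %| p} ->
  \prod_(la <- rs) ('X - la%:P) ^+ e %| p.
Proof.
elim: rs => [|la rs IH] /=; first by rewrite big_nil dvd1p.
move=> /andP[lars urs] h; rewrite big_cons Gauss_dvdp ?coprimep_XsubC_prod //.
rewrite h ?mem_head // IH // => mu mur; apply: h.
by rewrite inE mur orbT.
Qed.

End CoprimePowers.

(** * Generalized eigenfunctions of a self-map *)

Section PolynomialAction.
Variables (k : closedFieldType) (X : Type) (g : X -> X).
Implicit Types (p q : {poly k}) (f : X -> k).

(** The k[T]-module structure on functions in which T acts as pullback along [g]. *)
Definition pact q f : X -> k := fun x => \sum_(i < size q) q`_i * f (iter i g x).

Lemma pact_wide n q f x : (size q <= n)%N ->
  pact q f x = \sum_(i < n) q`_i * f (iter i g x).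
Proof.
move=> le; rewrite /pact (big_ord_widen n (fun i => q`_i * f (iter i g x))) //.
rewrite big_mkcond; apply: eq_bigr => i _; case: ltnP => // h.
by rewrite nth_default // mul0r.
Qed.

Lemma pactDl p q f x : pact (p + q) f x = pact p f x + pact q f x.
Proof.
pose n := maxn (size p) (size q).
rewrite !(@pact_wide n) ?leq_maxl ?leq_maxr ?size_polyD // -big_split.
by apply: eq_bigr => i _; rewrite coefD mulrDl.
Qed.

Lemma pactC c f x : pact c%:P f x = c * f x.
Proof. by rewrite (@pact_wide 1) ?size_polyC_leq1 // big_ord1 coefC. Qed.

Lemma pact0l f x : pact 0 f x = 0.
Proof. by rewrite -[0]/(0%:P) pactC mul0r. Qed.

Lemma pactMX p f x : pact (p * 'X) f x = pact p f (g x).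
Proof.
rewrite (@pact_wide (size p).+1); last first.
  by apply: leq_trans (size_polyMleq _ _) _; rewrite size_polyX addn2.
rewrite big_ord_recl coefMX mul0r add0r; apply: eq_bigr => i _.
by rewrite coefMX /= -iterS iterSr.
Qed.

Lemma pactDr p f f' x : pact p (fun y => f y + f' y) x = pact p f x + pact p f' x.
Proof. by rewrite -big_split; apply: eq_bigr => i _; rewrite mulrDr. Qed.

Lemma pactZr p c f x : pact p (fun y => c * f y) x = c * pact p f x.
Proof. by rewrite /pact mulr_sumr; apply: eq_bigr => i _; rewrite mulrCA. Qed.

Lemma pact_sumr (I : finType) p (F : I -> X -> k) x :
  pact p (fun y => \sum_i F i y) x = \sum_i pact p (F i) x.
Proof.
rewrite /pact exchange_big; apply: eq_bigr => i _.
by rewrite mulr_sumr.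
Qed.

Lemma pact0r p f x : (forall y, f y = 0) -> pact p f x = 0.
Proof. by move=> f0; apply: big1 => i _; rewrite f0 mulr0. Qed.

Lemma pactM p q f x : pact (p * q) f x = pact p (pact q f) x.
Proof.
elim/poly_ind: p x => [|p c IH] x; first by rewrite mul0r !pact0l.
rewrite mulrDl mulrAC !pactDl !pactMX IH pactC; congr (_ + _).
elim/poly_ind: q x {IH} => [|q d IH] x; first by rewrite mulr0 !pact0l mulr0.
rewrite mulrDr mulrA !pactDl !pactMX IH -polyCM !pactC.
by rewrite mulrDr mulrA.
Qed.

Lemma pactB1 la f x : pact ('X - la%:P) f x = f (g x) - la * f x.
Proof.
by rewrite -polyCN pactDl pactC -['X]mul1r pactMX -[1]/(1%:P) pactC mul1r mulNr.
Qed.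

Lemma pact_Xn n f x : pact 'X^n f x = f (iter n g x).
Proof.
elim: n x => [|n IH] x; first by rewrite expr0 -[1]/(1%:P) pactC mul1r.
by rewrite exprSr pactMX IH -iterSr.
Qed.

Lemma pact_comp (s : X -> X) q f : (forall x, s (g x) = g (s x)) ->
  forall x, pact q (fun y => f (s y)) x = pact q f (s x).
Proof.
move=> sg x; apply: eq_bigr => i _; congr (_ * f _).
by elim: (nat_of_ord i) => //= n <-.
Qed.

Lemma pact_dvd p q f : p %| q -> (forall x, pact p f x = 0) ->
  forall x, pact q f x = 0.
Proof.
by move=> /dvdpP[r ->] pf x; rewrite pactM pact0r.
Qed.

Definition gen_eigen la f := exists e, forall x, pact (('X - la%:P) ^+ e) f x = 0.

Lemma gen_eigen_comp (s : X -> X) la f : (forall x, s (g x) = g (s x)) ->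
  gen_eigen la f -> gen_eigen la (fun x => f (s x)).
Proof. by move=> sg [e ef]; exists e => x; rewrite pact_comp. Qed.

(** Applying T - la mu to f f' gives ((T - la) f) (T f') + la f ((T - mu) f'). The first term lowers
    one exponent, the second the other. *)
Lemma gen_eigenM la mu f f' : gen_eigen la f -> gen_eigen mu f' ->
  gen_eigen (la * mu) (fun x => f x * f' x).
Proof.
move=> [e fe] [e' fe']; exists (e + e')%N => x.
have [n] := ubnP (e + e'); elim: n e e' f f' fe fe' x => // n IH e e' f f' fe fe' x.
case: e fe => [|e] fe.
  by move=> _; apply: pact0r => y; have := fe y;
    rewrite expr0 -[1]/(1%:P) pactC mul1r => ->; rewrite mul0r.
case: e' fe' => [|e'] fe'.
  by move=> _; apply: pact0r => y; have := fe' y;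
    rewrite expr0 -[1]/(1%:P) pactC mul1r => ->; rewrite mulr0.
rewrite addSn ltnS => le; rewrite exprSr pactM.
pose u y := pact ('X - la%:P) f y; pose v y := pact ('X - mu%:P) f' y.
have -> : pact ('X - (la * mu)%:P) (fun y => f y * f' y) =
    fun y => u y * f' (g y) + la * (f y * v y).
  by apply/funext => y; rewrite /u /v !pactB1; ring.
rewrite pactDr pactZr (IH e e'.+1) //; first last.
- by move=> y; rewrite pact_comp // fe'.
- by move=> y; rewrite -pactM -exprSr.
rewrite addnS -addSn (IH e.+1 e') ?mulr0 ?addr0 //.
- by move=> y; rewrite -pactM -exprSr.
- by move: le; rewrite addnS addSn.
Qed.

Lemma gen_eigen_cst c : gen_eigen 1 (fun=> c).
Proof. by exists 1%N => x; rewrite expr1 pactB1 mul1r subrr. Qed.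

(* On a finite sum of generalized eigenfunctions, multiplying the component of
   eigenvalue la by v la is the action of one polynomial; hence it depends only
   on the sum. *)
Lemma gen_eigen_sum0 (I : finType) (la : I -> k) (F : I -> X -> k) (v : k -> k) :
  (forall i, gen_eigen (la i) (F i)) -> (forall x, \sum_i F i x = 0) ->
  forall x, \sum_i v (la i) * F i x = 0.
Proof.
move=> /choice[e eF] F0 x; pose E := \max_i e i.
have [Q QP] := chinese_XsubC E v (undup_uniq (codom la)).
have QF i y : pact Q (F i) y = v (la i) * F i y.
  rewrite -[Q](subrK (v (la i))%:P) pactDl pactC.
  rewrite (@pact_dvd (('X - (la i)%:P) ^+ e i)) ?add0r //.
  apply: dvdp_trans (QP (la i) _); last by rewrite mem_undup codom_f.
  by apply: dvdp_exp2l; apply: leq_bigmax.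
under eq_bigr do rewrite -QF.
by rewrite -pact_sumr; apply: pact0r.
Qed.

Variables (G : set k) (chi : k -> k).
Hypothesis chiP : torsion_character G chi.

(* f' is the image of f under the scaling of each generalized eigenspace by the
   value of chi at its eigenvalue. *)
Definition twisted f f' : Prop :=
  exists (I : finType) (la : I -> k) (F : I -> X -> k),
    [/\ forall i, G (la i), forall i, gen_eigen (la i) (F i),
      forall x, f x = \sum_i F i x & forall x, f' x = \sum_i chi (la i) * F i x].

Lemma twisted_eigen la f : G la -> gen_eigen la f ->
  twisted f (fun x => chi la * f x).
Proof.
move=> Gla laf; exists unit, (fun=> la), (fun=> f).
by split=> // x; rewrite big_const card_unit /= addr0.
Qed.

Lemma twisted_cst c : twisted (fun=> c) (fun=> c).
Proof.
have := twisted_eigen (tchar1 chiP) (gen_eigen_cst c).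
by rewrite (tchar_one chiP) mul1r.
Qed.

Lemma twistedD f1 f1' f2 f2' : twisted f1 f1' -> twisted f2 f2' ->
  twisted (fun x => f1 x + f2 x) (fun x => f1' x + f2' x).
Proof.
move=> [I [la [F [GI EI fE f'E]]]] [J [mu [H [GJ EJ hE h'E]]]].
exists (I + J)%type, (fun s => match s with inl i => la i | inr j => mu j end).
exists (fun s => match s with inl i => F i | inr j => H j end).
split=> [[i|j]|[i|j]|x|x] //; rewrite big_sumType /=.
  by rewrite fE hE.
by rewrite f'E h'E.
Qed.

Lemma twistedM f1 f1' f2 f2' : twisted f1 f1' -> twisted f2 f2' ->
  twisted (fun x => f1 x * f2 x) (fun x => f1' x * f2' x).
Proof.
move=> [I [la [F [GI EI fE f'E]]]] [J [mu [H [GJ EJ hE h'E]]]].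
exists (I * J)%type, (fun s => la s.1 * mu s.2), (fun s x => F s.1 x * H s.2 x).
split=> [s|s|x|x].
- exact: (tcharM chiP).
- exact: gen_eigenM.
- rewrite fE hE big_distrlr /= pair_big; exact: eq_bigr.
- rewrite f'E h'E big_distrlr /= pair_big; apply: eq_bigr => s _ /=.
  by rewrite (tchar_morph chiP) // mulrACA.
Qed.

(** The difference of two decompositions of [f] decomposes 0, to which [gen_eigen_sum0] applies. *)
Lemma twisted_unique f f' f'' : twisted f f' -> twisted f f'' -> f' =1 f''.
Proof.
move=> tw [J [mu [H [GJ EJ hE h'E]]]] x.
have tN : twisted (fun x => -1 * f x) (fun x => -1 * f'' x).
  exists J, mu, (fun j x => -1 * H j x); split=> // [j|y|y].
  - by have [e eH] := EJ j; exists e => y; rewrite pactZr eH mulr0.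
  - by rewrite hE mulr_sumr.
  - by rewrite h'E mulr_sumr; apply: eq_bigr => j _; rewrite mulrCA.
have [I [la [F [_ EI fE f'E]]]] := twistedD tw tN.
have F0 y : \sum_i F i y = 0 by rewrite -fE mulN1r subrr.
have := gen_eigen_sum0 chi EI F0 x.
by rewrite -f'E mulN1r => /eqP; rewrite subr_eq0 => /eqP.
Qed.

Lemma twisted_comp (s : X -> X) f f' : (forall x, s (g x) = g (s x)) ->
  twisted f f' -> twisted (fun x => f (s x)) (fun x => f' (s x)).
Proof.
move=> sg [I [la [F [GI EI fE f'E]]]].
exists I, la, (fun i x => F i (s x)); split=> // i.
exact: gen_eigen_comp.
Qed.

Lemma twisted_meval n (P : {mpoly k[n]}) (u u' : 'I_n -> X -> k) :
  (forall i, twisted (u i) (u' i)) ->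
  twisted (fun x => P.@[u^~ x]) (fun x => P.@[u'^~ x]).
Proof.
(* A function and its twist are coded as one function on bool * X, so that [closure_meval] treats
   both at once. *)
pose C (w : bool * X -> k) := twisted (fun x => w (true, x)) (fun x => w (false, x)).
move=> tw; have := @closure_meval k (bool * X)%type C _ _ _ n P
  (fun i w => if w.1 then u i w.2 else u' i w.2).
apply=> //.
- exact: twisted_cst.
- by move=> *; apply: twistedD.
- by move=> *; apply: twistedM.
Qed.

End PolynomialAction.

Lemma binomial_poly (k : fieldType) (k_char0 : [pchar k] =i pred0) j :
  exists Q : {poly k}, forall n, Q.[n%:R] = ('C(n, j))%:R.
Proof.
exists ((j`!%:R)^-1 *: \prod_(l < j) ('X - (l%:R)%:P)) => n.
have j0 : j`!%:R != 0 :> k by rewrite (pcharf0P k).1 // -lt0n fact_gt0.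
apply: (mulfI j0); rewrite hornerZ mulVKf // -natrM mulnC bin_ffact.
rewrite horner_prod; under eq_bigr do rewrite hornerXsubC.
have [nj|jn] := ltnP n j.
  rewrite ffact_small // (bigD1 (Ordinal nj)) //=.
  by rewrite subrr mul0r.
rewrite ffact_prod natr_prod; apply: eq_bigr => l _.
by rewrite natrB // ltnW // (leq_trans (ltn_ord l)).
Qed.

(** * Automorphisms annihilated by a polynomial *)

Section AlgebraicAutomorphisms.
Variables (k : closedFieldType) (X : affine_variety k).
Hypothesis k_char0 : [pchar k] =i pred0.
Variable g : automorphism X.

Lemma regfun_pact q f : regfun f -> regfun (pact g q f).
Proof.
move=> rf; apply: regfun_sum => i _; apply: regfunZ.
exact: regfun_comp (iter_regular _ (aut_regular g)) rf.
Qed.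

(** Expanding T^n in powers of T - 1, only the terms of index below [e] survive, and their binomial
    coefficients are polynomial in n. *)
Lemma unipotent_eigenvalue1 e :
  (forall i x, pact g (('X - 1%:P) ^+ e) (fun y => coord y i) x = 0) ->
  unipotent g.
Proof.
move=> eX; have /choice[Q QE] j := binomial_poly k_char0 j.
apply: (@unipotent_interpolation _ k_char0 X g e (fun j => Q j)
  (fun j x i => pact g (('X - 1%:P) ^+ j) (fun y => coord y i) x)).
  by move=> l i; apply: regfun_pact; apply: regfun_coord.
move=> n x i; set f := fun y : X => coord y i.
have XE : 'X^n = \sum_(j < n.+1) ('C(n, j)%:R : k)%:P * ('X - 1%:P) ^+ j.
  rewrite -{1}['X](subrK 1%:P) -[1%:P in X in X ^+ n]/(1 : {poly k}) exprDn.
  rewrite (reindex_inj rev_ord_inj) /=; apply: eq_bigr => j _.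
  rewrite subSS subKn -1?ltnS // bin_sub -1?ltnS //.
  by rewrite expr1n mulr1 -mulr_natl polyC_natr.
(* The longer sum covers n < e and n >= e alike: the terms with j > n vanish by the binomial
   coefficient, those with j >= e by hypothesis. *)
transitivity (\sum_(j < n.+1 + e) 'C(n, j)%:R * pact g (('X - 1%:P) ^+ j) f x).
  rewrite -[LHS](pact_Xn g n f x) XE.
  rewrite (big_morph (fun p => pact g p f x) (fun p q => pactDl g p q f x)
    (pact0l g f x)).
  rewrite big_split_ord /= [X in _ = _ + X]big1 ?addr0 => [|j _].
    by apply: eq_bigr => j _; rewrite pactM pactC.
  by rewrite bin_small ?mul0r // ltn_addr.
rewrite addnC big_split_ord /= [X in _ + X]big1 ?addr0 => [|j _].
  by apply: eq_bigr => j _; rewrite QE.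
by rewrite exprD [X in pact g X]mulrC pactM pact0r ?mulr0 // => y; apply: eX.
Qed.

Lemma unipotent_of_algebraic (q : {poly k}) : q != 0 ->
  (forall i x, pact g q (fun y => coord y i) x = 0) ->
  (forall tau : automorphism X,
     (forall sg : automorphism X, (sg * g = g * sg)%g -> (sg * tau = tau * sg)%g) ->
     forall N, (0 < N)%N -> (forall x, iter N tau x = x) -> forall x, tau x = x) ->
  unipotent g.
Proof.
move=> q0 qX tors_free.
have [r qE] := closed_field_poly_normal q.
pose rs := undup r; pose e := size r; pose m := size rs.
pose Pi := \prod_(la <- rs) ('X - la%:P) ^+ e.
have urs : uniq rs by apply: undup_uniq.
have q_dvd : q %| Pi.
  rewrite qE dvdpZl ?lead_coef_eq0 // /Pi prodrXl.
  have sub : {subset r <= rs} by move=> x; rewrite mem_undup.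
  rewrite /e; elim: (r) sub => [|x s IH] sub; first by rewrite big_nil dvd1p.
  rewrite big_cons exprS dvdp_mul //; last first.
    by apply: IH => y ys; apply: sub; rewrite inE ys orbT.
  by rewrite (big_rem x) ?dvdp_mulr // sub ?mem_head.
have kill p i x : Pi %| p -> pact g p (fun y => coord y i) x = 0.
  by move=> h; apply: (pact_dvd (dvdp_trans q_dvd h)).
(* Modulo [Pi], a multiple of [q], these polynomials are the projectors onto the generalized
   eigenspaces; [Y i j] is a component of the i-th coordinate. *)
have /choice[E EP] j := chinese_XsubC e (fun la => (la == j)%:R) urs.
pose Y i (j : 'I_m) := pact g (E rs`_j) (fun y => coord y i).
have rsj (j : 'I_m) : rs`_j \in rs by apply: mem_nth.
have Yeig_e i (j : 'I_m) x : pact g (('X - (rs`_j)%:P) ^+ e) (Y i j) x = 0.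
  rewrite -pactM; apply: kill.
  apply: dvdp_prod_XsubC => // la lars; have [->|ne] := eqVneq la rs`_j.
    exact: dvdp_mulr.
  by have := EP rs`_j la lars; rewrite (negPf ne) subr0 => h; apply: dvdp_mull.
have Yeig i (j : 'I_m) : gen_eigen g rs`_j (Y i j).
  by exists e => x; apply: Yeig_e.
have YE i x : coord x i = \sum_j Y i j x.
  have sumE p : \sum_(j < m) pact g (E rs`_j) p x = pact g (\sum_(j < m) E rs`_j) p x.
    by rewrite (big_morph (fun h => pact g h p x) (fun h h' => pactDl g h h' p x)
      (pact0l g p x)).
  rewrite /Y sumE -[\sum_(j < m) _](subrK 1%:P) pactDl pactC mul1r.
  rewrite kill ?add0r //; apply: dvdp_prod_XsubC => // la lars.
  have lam : (index la rs < m)%N by rewrite index_mem.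
  rewrite (bigD1 (Ordinal lam)) //= nth_index // addrAC dvdp_add //.
    by have := EP la la lars; rewrite eqxx.
  elim/big_rec: _ => [|j p jla IH]; first exact: dvdp0.
  have ne : (la == rs`_j) = false.
    apply: contraNF jla => /eqP laE; apply/eqP/val_inj => /=.
    by rewrite laE index_uniq.
  by rewrite dvdp_add //; have := EP rs`_j la lars; rewrite ne subr0.
pose relevant (j : 'I_m) := `[< exists i x, Y i j x != 0 >].
have irrelevant i j x : ~~ relevant j -> Y i j x = 0.
  move=> /asboolPn h; apply/eqP/negPn/negP => h'.
  by apply: h; exists i, x.
have [all1|] := pselect (forall j, relevant j -> rs`_j = 1).
  apply: (@unipotent_eigenvalue1 e) => i x.
  have -> : (fun y => coord y i) = fun y => \sum_j Y i j y.
    by apply/funext => y; apply: YE.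
  rewrite pact_sumr; apply: big1 => j _; case: (boolP (relevant j)) => rj.
    by rewrite -(all1 j rj) Yeig_e.
  by apply: pact0r => y; apply: irrelevant.
move=> /existsNP[j0 /not_implyP[rj0 /eqP j0N1]].
(* Components that vanish identically get the eigenvalue 1, because the root of [q] attached to them
   may be 0. *)
pose lam j := if relevant j then rs`_j else 1.
have lam0 : {in codom lam, forall la, la != 0}.
  move=> _ /codomP[j ->]; rewrite /lam; case: ifP => rj; last exact: oner_neq0.
  apply/eqP => la0; have /asboolP[i [x /eqP]] := rj; apply.
  (* A component of eigenvalue 0 is killed by pullback along the e-th iterate of [g], which is
     surjective, so it vanishes. *)
  have := Yeig_e i j; rewrite la0 polyC0 subr0 => h.
  have surj n : exists y, iter n g y = x.
    elim: n => [|n [y <-]]; first by exists x.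
    by exists (aut_inv g y); rewrite iterSr aut_invK.
  by have [y <-] := surj e; rewrite -pact_Xn.
have lamj0 : lam j0 != 1 by rewrite /lam rj0.
have [G [chi [chiP Gl chi1]]] :=
  torsion_character_exists k_char0 lam0 (codom_f lam j0) lamj0.
have lamEig i j : gen_eigen g (lam j) (Y i j).
  rewrite /lam; case: ifP => rj; first exact: Yeig.
  by exists 0%N => x; apply: pact0r => y; apply: irrelevant; rewrite rj.
pose t0 (x : X) i := \sum_j chi (lam j) * Y i j x.
have Glam j : G (lam j) by apply: Gl; apply: codom_f.
have tw_coord i : twisted g G chi (fun x => coord x i) (fun x => t0 x i).
  exists 'I_m, lam, (fun j => Y i j); split=> // x; exact: YE.
(* An equation [P] of [X] is the zero function on [X]. Both 0 and P evaluated at [t0] are twists of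
   it, so they coincide. *)
have t0X x : (\row_i t0 x i) \in (X : set _).
  apply: mem_set; have [S XS] := points_closed X; rewrite XS => P SP.
  have tP := twisted_meval chiP P tw_coord.
  have tz : twisted g G chi (fun y : X => P.@[coord y]) (fun=> 0).
    have -> : (fun y : X => P.@[coord y]) = fun=> 0.
      apply/funext => y; have := set_mem (valP y); rewrite {1}XS; exact.
    exact: twisted_cst.
  rewrite -(twisted_unique tP tz x); apply: meval_eq => i.
  by rewrite mxE.
pose t (x : X) : X := exist _ (\row_i t0 x i) (t0X x).
have tE x i : coord (t x) i = t0 x i by rewrite /coord mxE.
have rY i j : regfun (Y i j) by apply: regfun_pact; apply: regfun_coord.
have t_reg : regular t.
  apply/regularP => i; under eq_fun do rewrite tE.
  by apply: regfun_sum => j _; apply: regfunZ.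
have tw f : regfun f -> twisted g G chi f (fun x => f (t x)).
  move=> [P ->]; have := twisted_meval chiP P tw_coord.
  congr (twisted _ _ _ _ _); apply/funext => x; apply: meval_eq => i.
  by rewrite tE.
have Yt i j x : Y i j (t x) = chi (lam j) * Y i j x.
  by have := twisted_unique (tw _ (rY i j)) (twisted_eigen chi (Glam j) (lamEig i j)).
have Ytn n i j x : Y i j (iter n t x) = chi (lam j) ^+ n * Y i j x.
  elim: n => [|n IH]; first by rewrite mul1r.
  by rewrite iterS Yt IH mulrA -exprS.
have /choice[N NP] j : exists n, (0 < n)%N /\ chi (lam j) ^+ n = 1.
  by have [n n0 h] := tchar_torsion chiP (Glam j); exists n.
pose M := (\prod_j N j)%N.
have M0 : (0 < M)%N by apply: prodn_gt0 => j; have [] := NP j.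
have tM x : iter M t x = x.
  apply: coord_inj => i; rewrite !YE; apply: eq_bigr => j _; rewrite Ytn.
  rewrite /M (bigD1 j) //= exprM; have [_ ->] := NP j.
  by rewrite expr1n mul1r.
have tK : cancel t (iter M.-1 t) by move=> x; rewrite -iterSr prednK.
have tVK : cancel (iter M.-1 t) t by move=> x; rewrite -iterS prednK.
pose tau := Automorphism t_reg (iter_regular M.-1 t_reg) tK tVK.
(* The coordinates of sg (t x) and of t (sg x) are both twists of those of sg x, hence equal. *)
have taug (sg : automorphism X) : (sg * g = g * sg)%g -> (sg * tau = tau * sg)%g.
  move=> comm; apply: automorphism_ext => x; apply: coord_inj => i /=.
  have sgg y : sg (g y) = g (sg y).
    exact: (congr1 (fun f : automorphism X => f y) comm).
  have rs_i := regular_coord i (aut_regular sg).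
  have h1 := tw _ rs_i.
  have h2 := twisted_comp sgg (tw _ (regfun_coord i)).
  exact: twisted_unique h1 h2 x.
have triv := tors_free tau taug M M0 tM.
have /asboolP[i [x Yx]] := rj0.
case/negP: chi1; apply/eqP; apply: (mulIf Yx); rewrite mul1r -Yt.
by rewrite (triv x : t x = x).
Qed.

End AlgebraicAutomorphisms.

Record zmod_action (H : zmodType) (T : Type) := ZmodAction {
  zact :> H -> T -> T;
  zact0 : forall x, zact 0 x = x;
  zactD : forall s t x, zact (s + t) x = zact s (zact t x) }.

(** * Uncountable commutative families of automorphisms *)

(* Transition operators of a commutative group action. A point None, fixed by
   everything, is added so that the operators form a nontrivial ring even when T
   is empty. *)
Section Operators.
Variables (k : closedFieldType) (H : zmodType) (T : Type) (act : zmod_action H T).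

Definition oact (s : H) : option T -> option T := omap (act s).

Lemma oact0 w : oact 0 w = w.
Proof. by case: w => //= x; rewrite zact0. Qed.

Lemma oactD s t w : oact (s + t) w = oact s (oact t w).
Proof. by case: w => //= x; rewrite zactD. Qed.

Notation F := (option T -> k).

(** The finite combination is only asserted to exist, so operators that agree as functions are equal
    and the ring laws are checked pointwise. *)
Record operator := Operator {
  op_fun :> F -> F;
  operatorP : exists l : seq (k * H),
    op_fun = fun f w => \sum_(p <- l) p.1 * f (oact p.2 w) }.

Lemma operator_ext (u v : operator) : (forall f w, u f w = v f w) -> u = v.
Proof.
case: u v => [u uP] [v vP] /= uv.
have e : u = v by apply/funext => f; apply/funext => w.
by subst v; congr Operator; apply: Prop_irrelevance.
Qed.

HB.instance Definition _ := gen_eqMixin operator.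
HB.instance Definition _ := gen_choiceMixin operator.

Lemma opD_subproof (u v : operator) : exists l : seq (k * H),
  (fun f w => u f w + v f w) = fun f w => \sum_(p <- l) p.1 * f (oact p.2 w).
Proof.
have [l ->] := operatorP u; have [m ->] := operatorP v.
by exists (l ++ m); apply/funext => f; apply/funext => w; rewrite big_cat.
Qed.

Lemma opZ_subproof c (u : operator) : exists l : seq (k * H),
  (fun f w => c * u f w) = fun f w => \sum_(p <- l) p.1 * f (oact p.2 w).
Proof.
have [l ->] := operatorP u; exists [seq (c * p.1, p.2) | p <- l].
apply/funext => f; apply/funext => w; rewrite big_map mulr_sumr.
by apply: eq_bigr => p _; rewrite mulrA.
Qed.

Lemma op_of_subproof t : exists l : seq (k * H),
  (fun (f : F) w => f (oact t w)) = fun f w => \sum_(p <- l) p.1 * f (oact p.2 w).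
Proof.
exists [:: (1, t)]; apply/funext => f; apply/funext => w.
by rewrite big_seq1 mul1r.
Qed.

Lemma opM_subproof (u v : operator) : exists l : seq (k * H),
  (fun f => u (v f)) = fun f w => \sum_(p <- l) p.1 * f (oact p.2 w).
Proof.
have [l ->] := operatorP u; have [m ->] := operatorP v.
exists [seq (p.1 * q.1, q.2 + p.2) | p <- l, q <- m].
apply/funext => f; apply/funext => w; rewrite big_allpairs_dep.
apply: eq_bigr => p _; rewrite mulr_sumr; apply: eq_bigr => q _ /=.
by rewrite oactD mulrA.
Qed.

Definition op_add u v := Operator (opD_subproof u v).
Definition op_scale c u := Operator (opZ_subproof c u).
Definition op_mul u v := Operator (opM_subproof u v).
Definition op_of t := Operator (op_of_subproof t).

Lemma op_addA : associative op_add.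
Proof. by move=> u v x; apply: operator_ext => f w /=; rewrite addrA. Qed.

Lemma op_addC : commutative op_add.
Proof. by move=> u v; apply: operator_ext => f w /=; rewrite addrC. Qed.

Lemma op_add0 : left_id (op_scale 0 (op_of 0)) op_add.
Proof. by move=> u; apply: operator_ext => f w /=; rewrite mul0r add0r. Qed.

Lemma op_addN : left_inverse (op_scale 0 (op_of 0)) (op_scale (-1)) op_add.
Proof.
by move=> u; apply: operator_ext => f w /=; rewrite mulN1r mul0r addNr.
Qed.

HB.instance Definition _ :=
  GRing.isZmodule.Build operator op_addA op_addC op_add0 op_addN.

Lemma op_mulA : associative op_mul.
Proof. by move=> u v x; apply: operator_ext. Qed.

Lemma op_mulC : commutative op_mul.
Proof.
move=> u v; apply: operator_ext => f w /=.
have [l ->] := operatorP u; have [m ->] := operatorP v.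
under eq_bigr do rewrite mulr_sumr.
rewrite exchange_big; apply: eq_bigr => q _; rewrite mulr_sumr.
by apply: eq_bigr => p _; rewrite -!oactD addrC mulrCA.
Qed.

Lemma op_mul1 : left_id (op_of 0) op_mul.
Proof. by move=> u; apply: operator_ext => f w /=; rewrite oact0. Qed.

Lemma op_mulD : left_distributive op_mul op_add.
Proof. by move=> u v x; apply: operator_ext. Qed.

Lemma op_one_neq0 : op_of 0 != 0.
Proof.
apply/eqP => /(congr1 (fun u : operator => u (fun=> 1) None)) /= /eqP.
by rewrite mul0r oner_eq0.
Qed.

HB.instance Definition _ := GRing.Zmodule_isComNzRing.Build operator
  op_mulA op_mulC op_mul1 op_mulD op_one_neq0.

Lemma op_scaleA c d (u : operator) : op_scale c (op_scale d u) = op_scale (c * d) u.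
Proof. by apply: operator_ext => f w /=; rewrite mulrA. Qed.

Lemma op_scale1 : left_id 1 op_scale.
Proof. by move=> u; apply: operator_ext => f w /=; rewrite mul1r. Qed.

Lemma op_scaleDr : right_distributive op_scale +%R.
Proof. by move=> c u v; apply: operator_ext => f w /=; rewrite mulrDr. Qed.

Lemma op_scaleDl (u : operator) : {morph op_scale^~ u : c d / c + d}.
Proof. by move=> c d; apply: operator_ext => f w /=; rewrite mulrDl. Qed.

HB.instance Definition _ := GRing.Zmodule_isLmodule.Build k operator
  op_scaleA op_scale1 op_scaleDr op_scaleDl.

Lemma op_scaleAl c (u v : operator) : c *: (u * v) = c *: u * v.
Proof. exact: operator_ext. Qed.

HB.instance Definition _ := GRing.Lmodule_isLalgebra.Build k operator op_scaleAl.
HB.instance Definition _ := GRing.Lalgebra_isComAlgebra.Build k operator.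

Definition op_eval (y : F) (u : operator) : option T -> k^o := u y.

Lemma op_eval_linear y : linear (op_eval y).
Proof. by []. Qed.

HB.instance Definition _ y :=
  GRing.isLinear.Build k operator (option T -> k^o) _ (op_eval y) (op_eval_linear y).

Lemma horner_op_of t (q : {poly k}) (f : F) w :
  (horner_alg (op_of t) q : operator) f w = pact (oact t) q f w.
Proof.
elim/poly_ind: q f w => [|p c IH] f w.
  by rewrite rmorph0 pact0l /= mul0r.
rewrite rmorphD rmorphM /= horner_algX horner_algC pactDl pactMX pactC.
rewrite -(@pact_comp _ _ _ (oact t)) // -IH /=.
by rewrite oact0.
Qed.

End Operators.

(** * Combinations of a sequence of vectors *)

Section PolynomialCombination.
Variables (k : fieldType) (M : lmodType k) (b : nat -> M).

Definition poly_comb (P : {poly k}) : M := \sum_(j < size P) P`_j *: b j.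

Lemma poly_comb_wide n (P : {poly k}) : (size P <= n)%N ->
  poly_comb P = \sum_(j < n) P`_j *: b j.
Proof.
move=> le; rewrite /poly_comb (big_ord_widen n (fun j => P`_j *: b j)) //.
rewrite big_mkcond; apply: eq_bigr => j _; case: ltnP => // h.
by rewrite nth_default // scale0r.
Qed.

Lemma poly_comb_linear : linear poly_comb.
Proof.
move=> c P Q; pose n := maxn (size P) (size Q).
have le : (size (c *: P + Q)%R <= n)%N.
  apply: leq_trans (size_polyD _ _) _; rewrite geq_max leq_maxr andbT.
  by apply: leq_trans (size_scale_leq _ _) (leq_maxl _ _).
rewrite !(@poly_comb_wide n) ?leq_maxl ?leq_maxr // scaler_sumr -big_split.
by apply: eq_bigr => j _; rewrite coefD coefZ scalerDl scalerA.
Qed.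

HB.instance Definition _ :=
  GRing.isLinear.Build k {poly k} M _ poly_comb poly_comb_linear.

Lemma poly_comb_Xn n : poly_comb 'X^n = b n.
Proof.
rewrite /poly_comb size_polyXn (bigD1 ord_max) //= coefXn eqxx scale1r.
rewrite big1 ?addr0 // => j /negPf jn; rewrite coefXn -[n in _ == n]/(val (@ord_max n)).
by rewrite val_eqE jn scale0r.
Qed.

End PolynomialCombination.

(** * Algebraic automorphisms in a one-parameter family *)

Section UncountableFamily.
Variables (k : closedFieldType) (Y : affine_variety k).
Hypothesis k_uncountable : ~ countable [set: k].
Variable act : k -> Y -> Y.
Hypothesis act_regular : forall t, regular (act t).
Hypothesis act0 : forall x, act 0 x = x.
Hypothesis actD : forall s t x, act (s + t) x = act s (act t x).

Let n := ambient_dim Y.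
(** A polynomial map from [Y] to its ambient space is treated as one scalar function on [T]; the
    identity map becomes [y] below. *)
Let T := (Y * 'I_n)%type.
Let tact_fun (t : k) (w : T) : T := (act t w.1, w.2).

Let tact0 w : tact_fun 0 w = w.
Proof. by case: w => x i; rewrite /tact_fun act0. Qed.

Let tactD s t w : tact_fun (s + t) w = tact_fun s (tact_fun t w).
Proof. by rewrite /tact_fun actD. Qed.

Let tact := ZmodAction tact0 tactD.

Let y (w : option T) : k := if w is Some (x, i) then coord x i else 0.

(** Monomials placed in a single coordinate, enumerated by [unpickle]; they span the polynomial
    maps, which thus have countable dimension. *)
Let mono (j : nat) : option T -> k^o := fun w =>
  match w, (unpickle j : option ('I_n * 'X_{1..n})) with
  | Some (x, i), Some (i', m) => (i == i')%:R * ('X_[m] : {mpoly k[n]}).@[coord x]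
  | _, _ => 0
  end.

(** Evaluated at [y], the operators give polynomial maps, so [algebraic_element] applies to t |->
    [op_of] t; the relation it yields, read at [y], is an annihilating polynomial for the
    coordinates. *)
Lemma algebraic_in_uncountable_family :
  exists t (q : {poly k}), [/\ t != 0, q != 0 &
    forall i x, pact (act t) q (fun x => coord x i) x = 0].
Proof.
have evB (r : operator k tact) : exists P, op_eval y r = poly_comb mono P.
  have [l lE] := operatorP r.
  have /choice[P PE] i : exists P : {mpoly k[n]},
      (fun x => r y (Some (x, i))) = fun x => P.@[coord x].
    rewrite lE /=; apply: regfun_sum => p _; apply: regfunZ.
    exact: regular_coord (act_regular p.2).
  exists (\sum_i \sum_(m <- msupp (P i)) (P i)@_m *: 'X^(pickle (i, m))).
  rewrite linear_sum /=; under eq_bigr => i _.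
    rewrite linear_sum /=; under eq_bigr do rewrite linearZ /= poly_comb_Xn.
    over.
  have scaleE c (u : option T -> k^o) w : (c *: u) w = c * u w by [].
  apply/funext => -[[x i]|]; rewrite fct_sumE; last first.
    rewrite /op_eval lE big1 => [|p _]; last by rewrite /= mulr0.
    by rewrite big1 // => i _; rewrite fct_sumE big1 // => m _; rewrite scaleE mulr0.
  rewrite (bigD1 i) //= [X in _ + X]big1 ?addr0 => [|i' /negPf ii']; last first.
    rewrite fct_sumE big1 // => m _; rewrite scaleE /mono pickleK eq_sym ii' mul0r.
    exact: mulr0.
  rewrite fct_sumE /op_eval (congr1 (@^~ x) (PE i)) {1}[P i]mpolyE.
  rewrite (raddf_sum (meval _)) /=; apply: eq_bigr => m _.
  by rewrite scaleE mevalZ /mono pickleK eqxx mul1r.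
have evM (s r : operator k tact) : op_eval y r = 0 -> op_eval y (s * r) = 0.
  move=> r0; rewrite /op_eval /= -[op_fun r y]/(op_eval y r) r0.
  have [l ->] := operatorP s; apply/funext => w.
  by apply: big1 => p _; rewrite mulr0.
have eD s t : op_of k tact (s + t) = op_of k tact s * op_of k tact t.
  by apply: operator_ext => f w /=; rewrite addrC oactD.
have [t [q [t0 q0 tq]]] :=
  algebraic_element k_uncountable evB evM k_uncountable (erefl : op_of k tact 0 = 1) eD.
exists t, q; split=> // i x.
transitivity (pact (oact tact t) q y (Some (x, i))); last first.
  by rewrite -horner_op_of; exact: (congr1 (@^~ (Some (x, i))) tq).
have iterE m : iter m (oact tact t) (Some (x, i)) = Some (iter m (act t) x, i).
  by elim: m => //= m ->.
by apply: eq_bigr => j _; rewrite iterE.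
Qed.

End UncountableFamily.

(** * Transport of unipotent elements by a group isomorphism *)

Section GroupIsomorphisms.
Variable k : closedFieldType.
Hypothesis k_char0 : [pchar k] =i pred0.

Lemma aut_expgE (X : affine_variety k) (f : automorphism X) n x :
  (f ^+ n)%g x = iter n f x.
Proof. by elim: n x => [|n IH] x //; rewrite expgS iterS /= -IH. Qed.

Lemma unipotent1 (X : affine_variety k) : unipotent (1%g : automorphism X).
Proof.
apply: (@unipotent_interpolation _ k_char0 X 1%g 1 (fun=> 1) (fun _ x i => coord x i)).
  by move=> _ i; apply: regfun_coord.
move=> n x i; rewrite big_ord1 hornerC mul1r; congr (coord _ i).
by elim: n.
Qed.

End GroupIsomorphisms.

Theorem corollary2 (k : closedFieldType) (k_char0 : [pchar k]%R =i pred0)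
    (k_uncountable : ~~ countable [set: k]%classic)
    (X Y : affine_variety k)
    (X_irr : irreducible_variety X) (Y_irr : irreducible_variety Y)
    (theta : {multiplicative automorphism X -> automorphism Y})
    (theta_bij : bijective theta) (phi : automorphism X) :
  unipotent phi -> unipotent (theta phi).
Proof.
move=> [a [t0 _ <-]].
have theta_inj := bij_inj theta_bij; have [eta thetaK etaK] := theta_bij.
have theta1 : theta 1%g = 1%g.
  by apply: (mulgI (theta 1%g)); rewrite -gmulfM !mulg1.
have thetaX f n : theta (f ^+ n)%g = (theta f ^+ n)%g.
  by elim: n => [|n IH]; rewrite ?expg0 // !expgS gmulfM IH.
have [triv|nontriv] := pselect (Ga_aut a t0 = 1%g).
  by rewrite triv theta1; apply: unipotent1.
have t0N0 : t0 != 0.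
  apply/eqP => t00; apply: nontriv; apply: automorphism_ext => x /=.
  by rewrite t00 Ga_act0.
have a_nontriv : exists t x, a t x <> x.
  exists t0; apply: contrapT => /forallNP h; apply: nontriv.
  by apply: automorphism_ext => x; apply: contrapT; apply: h.
pose act t := aut_fun (theta (Ga_aut a t)).
have act0 y : act 0 y = y.
  rewrite /act (_ : Ga_aut a 0 = 1%g) ?theta1 //.
  by apply: automorphism_ext => x /=; rewrite Ga_act0.
have actD s t y : act (s + t) y = act s (act t y) by rewrite /act Ga_autD gmulfM.
have [h [q [h0 q0 hq]]] := algebraic_in_uncountable_family (elimN idP k_uncountable)
  (fun t => aut_regular (theta (Ga_aut a t))) act0 actD.
set g := theta (Ga_aut a h).
(* The inverse isomorphism carries the double centralizer of [g] into that of a(h). *)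
have bicent_eta (tau : automorphism Y) :
    (forall sg : automorphism Y, (sg * g = g * sg)%g -> (sg * tau = tau * sg)%g) ->
    forall sg : automorphism X, (sg * Ga_aut a h = Ga_aut a h * sg)%g ->
      (sg * eta tau = eta tau * sg)%g.
  move=> tauP sg comm; apply: theta_inj; rewrite !gmulfM etaK; apply: tauP.
  by rewrite -!gmulfM comm.
have [b [r _ bg]] : unipotent g.
  apply: (unipotent_of_algebraic k_char0 q0 hq) => tau /bicent_eta tauP N N0 tauN.
  (* The preimage of [tau] is b(r) for some action b. If r is nonzero, b(N r) = 1 with N r nonzero
     forces the whole action to be trivial. *)
  have [b [r _ br]] := bicentralizer_unipotent k_char0 X_irr h0 a_nontriv tauP.
  suff e1 : eta tau = 1%g by move=> y; rewrite -[tau]etaK e1 theta1.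
  have etaN : (eta tau ^+ N = 1)%g.
    apply: theta_inj; rewrite thetaX etaK theta1; apply: automorphism_ext => y.
    by rewrite aut_expgE tauN.
  rewrite -br; apply: automorphism_ext => x /=.
  have [->|rN0] := eqVneq r 0; first exact: Ga_act0.
  apply: (@Ga_trivial _ _ k_char0 b (r *+ N)).
    by rewrite -mulr_natr mulf_neq0 // (pcharf0P k).1 // -lt0n.
  move=> z; rewrite Ga_act_mulrn; have := aut_expgE (eta tau) N z.
  by rewrite etaN -br.
have g_nontriv : g <> 1%g.
  move=> g1; apply: nontriv; apply: automorphism_ext => x.
  apply: (Ga_trivial k_char0 h0) => z.
  have e : Ga_aut a h = 1%g by apply: theta_inj; rewrite theta1.
  by rewrite -[a h z]/(Ga_aut a h z) e.
have rN0 : r != 0.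
  apply/eqP => r0; apply: g_nontriv; rewrite -bg; apply: automorphism_ext => y /=.
  by rewrite r0 Ga_act0.
apply: (bicentralizer_unipotent (a := b) k_char0 Y_irr rN0).
  exists r; apply: contrapT => /forallNP nt; apply: g_nontriv; rewrite -bg.
  by apply: automorphism_ext => y; apply: contrapT; apply: nt.
(* The preimage of an element commuting with [g] commutes with a(h), hence with every a(t), in
   particular with a(t0). *)
rewrite bg => sg comm; rewrite -[sg]etaK -!gmulfM; congr (theta _).
apply: automorphism_ext => x /=; apply: (Ga_commute k_char0 h0).
by apply: theta_inj; rewrite !gmulfM etaK.
Qed.
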